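(* Let $n\ge 3$ and let $\mathfrak{g}=\mathfrak{sp}(2n,\mathbb{R})$. Then the real vector space $\mathcal{Q}(\mathfrak{g})=\widehat{\mathcal{Q}}(\mathfrak{g})/\mathfrak{g}^*$ of continuous Lie quasi-states on $\mathfrak{g}$ modulo linear functionals satisfies $\dim \mathcal{Q}(\mathfrak{g})=1$.
   Context: Here $\mathfrak{sp}(2n,\mathbb{R})$ is the Lie algebra of the group $Sp(2n,\mathbb{R})$ of real symplectic $2n\times 2n$ matrices. Let $\mathfrak{g}$ be a finite-dimensional real Lie algebra. A Lie quasi-state on $\mathfrak{g}$ is a function $\zeta:\mathfrak{g}\to\mathbb{R}$ such that whenever $[x_1,x_2]=0$ one has $\zeta(c_1x_1+c_2x_2)=c_1\zeta(x_1)+c_2\zeta(x_2)$ for all $c_1,c_2\in\mathbb{R}$. Let $\widehat{\mathcal{Q}}(\mathfrak{g})$ be the real vector space of all continuous Lie quasi-states on $\mathfrak{g}$; it contains the dual space $\mathfrak{g}^*$ of linear functionals. Put $\mathcal{Q}(\mathfrak{g}):=\widehat{\mathcal{Q}}(\mathfrak{g})/\mathfrak{g}^*$. *)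

(* Defs.v *)
From HB Require Import structures.
From mathcomp Require Import all_boot all_order all_algebra.
From mathcomp Require Import generic_quotient ring_quotient.
From mathcomp Require Import ring.
From mathcomp Require Import all_classical all_reals all_analysis.

Set Implicit Arguments.
Unset Strict Implicit.
Unset Printing Implicit Defensive.

Import Order.TTheory GRing.Theory Num.Theory.
Import numFieldNormedType.Exports.
Import passmx.
Local Open Scope ring_scope.
Local Open Scope quotient_scope.

(* Over a ring, closure under opposites follows from submodClosed, but the
   library does not infer it; submod_pred W is W with that instance. *)
Definition submod_pred (R : pzRingType) (V : lmodType R)
  (W : submodClosed V) : {pred V} := fun x => x \in W.

Fact submod_pred_zmod (R : pzRingType) (V : lmodType R) (W : submodClosed V) :
  zmod_closed (submod_pred W).
Proof. exact: GRing.submod_closedB (submodClosedP W). Qed.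

HB.instance Definition _ (R : pzRingType) (V : lmodType R)
  (W : submodClosed V) :=
  GRing.isZmodClosed.Build V (submod_pred W) (submod_pred_zmod W).

Definition lmod_quot (R : pzRingType) (V : lmodType R) (W : submodClosed V) :=
  Quotient.quot (submod_pred W).

HB.instance Definition _ (R : pzRingType) (V : lmodType R)
  (W : submodClosed V) := GRing.Zmodule.on (lmod_quot W).

Section LmodQuot.
Variables (R : pzRingType) (V : lmodType R) (W : submodClosed V).
Local Notation Q := (lmod_quot W).

Definition lmod_quot_proj (x : V) : Q := \pi_(Quotient.quot (submod_pred W)) x.

Definition lmod_quot_scale (a : R) (q : Q) : Q :=
  lmod_quot_proj (a *: repr (q : Quotient.quot (submod_pred W))).

Lemma lmod_quot_projP (x y : V) :
  lmod_quot_proj x = lmod_quot_proj y <-> x - y \in W.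
Proof.
split=> [/eqP|h]; first by rewrite -Quotient.idealrBE.
by apply/eqP; rewrite -Quotient.idealrBE.
Qed.

Lemma lmod_quot_reprK (q : Q) :
  lmod_quot_proj (repr (q : Quotient.quot (submod_pred W))) = q.
Proof. exact: reprK. Qed.

Lemma lmod_quot_projD (x y : V) :
  lmod_quot_proj (x + y) = lmod_quot_proj x + lmod_quot_proj y.
Proof. exact: (@Quotient.pi_add V (submod_pred W) x y). Qed.

Lemma lmod_quot_projZ (a : R) (x : V) :
  lmod_quot_proj (a *: x) = lmod_quot_scale a (lmod_quot_proj x).
Proof.
apply/lmod_quot_projP; rewrite -scalerBr; apply: rpredZ.
by apply/lmod_quot_projP; rewrite lmod_quot_reprK.
Qed.

Fact lmod_quot_scalerA (a b : R) (q : Q) :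
  lmod_quot_scale a (lmod_quot_scale b q) = lmod_quot_scale (a * b) q.
Proof.
by rewrite -(lmod_quot_reprK q) -!lmod_quot_projZ scalerA.
Qed.

Fact lmod_quot_scale1r : left_id 1 lmod_quot_scale.
Proof.
by move=> q; rewrite -(lmod_quot_reprK q) -!lmod_quot_projZ scale1r.
Qed.

Fact lmod_quot_scalerDr : right_distributive lmod_quot_scale +%R.
Proof.
move=> a p q; rewrite -(lmod_quot_reprK p) -(lmod_quot_reprK q).
by rewrite -lmod_quot_projD -!lmod_quot_projZ scalerDr lmod_quot_projD.
Qed.

Fact lmod_quot_scalerDl (q : Q) :
  {morph lmod_quot_scale^~ q : a b / a + b}.
Proof.
move=> a b; rewrite -(lmod_quot_reprK q) -!lmod_quot_projZ.
by rewrite scalerDl lmod_quot_projD.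
Qed.

HB.instance Definition _ := GRing.Zmodule_isLmodule.Build R Q
  lmod_quot_scalerA lmod_quot_scale1r lmod_quot_scalerDr lmod_quot_scalerDl.

Lemma lmod_quot_proj_is_linear : linear lmod_quot_proj.
Proof. by move=> a x y; rewrite lmod_quot_projD lmod_quot_projZ. Qed.

End LmodQuot.

Definition has_dim (R : nzRingType) (d : nat) (V : lmodType R) : Prop :=
  inhabited (Vector.axiom d V).

HB.mixin Record isLieAlgebra (R : fieldType) (L : Type) of Vector R L := {
  lie_bracket : L -> L -> L;
  lie_bracket_linearl : forall y, linear (lie_bracket^~ y);
  lie_bracket_linearr : forall x, linear (lie_bracket x);
  lie_bracket_alt : forall x, lie_bracket x x = 0;
  lie_bracket_jacobi : forall x y z,
    lie_bracket x (lie_bracket y z) + lie_bracket y (lie_bracket z x)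
    + lie_bracket z (lie_bracket x y) = 0
}.

#[short(type="lieAlgType")]
HB.structure Definition LieAlgebra (R : fieldType) :=
  { L of isLieAlgebra R L & Vector R L }.

Section ContinuousOnCoords.
Variable R : realType.

(* The topology of a finite-dimensional space is that of its coordinate space;
   by continuous_on_subvsP, for a space of matrices it is the topology induced
   by 'M[R]_(m, n), whatever the basis. *)
Definition continuous_on_coords (V : vectType R) (z : V -> R) : Prop :=
  continuous
    (fun v : 'rV[R]_(\dim {:V}) => z (vecof (vbasis {:V}) v)).

Lemma linear_mx_continuous (m n p q : nat)
  (f : {linear 'M[R]_(m, n) -> 'M[R]_(p, q)}) : continuous f.
Proof.
have sumC (T : topologicalType) (I : Type) (r : seq I) (F : I -> T -> R) :
    (forall i, continuous (F i)) -> continuous (fun x => \sum_(i <- r) F i x).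
  move=> cF; elim: r => [|i r ih] x.
    under [X in continuous_at _ X]funext do rewrite big_nil.
    exact: cst_continuous.
  under [X in continuous_at _ X]funext do rewrite big_cons.
  by apply: continuousD; [exact: cF|exact: ih].
suff h i j : continuous (fun B => f B i j).
  move=> A S [P hP PS].
  have : \forall B \near A, forall i j, P i j (f B i j).
    apply: (@filter_forall _ _ (fun i B => forall j, P i j (f B i j))
      (nbhs A) (nbhs_filter A)) => i.
    apply: (@filter_forall _ _ (fun j B => P i j (f B i j))
      (nbhs A) (nbhs_filter A)) => j.
    exact/h/hP.
  by apply: filterS => B hB; exact: PS.
have -> : (fun B => f B i j) =
    (fun B => \sum_k \sum_l B k l * f (delta_mx k l) i j).
  apply/funext => B; rewrite [in LHS](matrix_sum_delta B).
  rewrite !linear_sum summxE; apply: eq_bigr => k _.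
  rewrite !linear_sum summxE; apply: eq_bigr => l _.
  by rewrite linearZ mxE.
apply: (sumC) => k; apply: (sumC) => l B.
by apply: continuousM; [exact: coord_continuous|exact: cst_continuous].
Qed.

Lemma linear_continuous_on_coords (V : vectType R) (f : 'Hom(V, R^o)) :
  continuous_on_coords f.
Proof.
pose h (v : 'rV[R]_(\dim {:V})) : 'rV[R]_1 :=
  const_mx (f (vecof (vbasis {:V}) v)).
have hlin : linear h.
  by move=> a u v; apply/rowP => i; rewrite !mxE !linearP.
pose hL := GRing.isLinear.Build R _ _ _ h hlin.
pose H : {linear 'rV[R]_(\dim {:V}) -> 'rV[R]_1} := HB.pack h hL.
rewrite /continuous_on_coords.
have -> : (fun v => f (vecof (vbasis {:V}) v)) = (fun v => H v 0 0).
  by apply/funext => v; rewrite mxE.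
move=> v; apply: (@continuous_comp _ _ _ H (fun w : 'rV[R]_1 => w 0 0)).
  exact: linear_mx_continuous.
exact: coord_continuous.
Qed.

Lemma continuous_on_subvsP (m n : nat) (U : {vspace 'M[R]_(m, n)})
  (z : subvs_of U -> R) :
  continuous_on_coords z <->
  continuous (z : initial_topology (@vsval _ _ U) -> R).
Proof.
set e := vbasis {:subvs_of U}; have eB : basis_of {:subvs_of U} e := vbasisP _.
split=> cz.
  have -> : z = (fun v => z (vecof e v)) \o
      ((rVof e \o vsproj U) \o @vsval _ _ U).
    by apply/funext => x /=; rewrite rVofK// vsvalK.
  move=> x; apply: continuous_comp; last exact: cz.
  apply: continuous_comp; first exact: initial_continuous.
  exact: linear_mx_continuous.
move=> v; apply: (@continuous_comp _ (initial_topology (@vsval _ _ U)));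
  last exact: cz.
move: v; apply/continuousP => A [B oB <-].
have /continuousP := @linear_mx_continuous _ _ _ _ (@vsval _ _ U \o vecof e).
exact.
Qed.

End ContinuousOnCoords.

Section LieQuasiStates.
Variables (R : realType) (g : lieAlgType R).

Definition lie_quasi_state (z : g -> R) : Prop :=
  forall x1 x2 : g, lie_bracket x1 x2 = 0 ->
  forall c1 c2 : R, z (c1 *: x1 + c2 *: x2) = c1 * z x1 + c2 * z x2.

Definition quasi_state_pred : {pred g -> R^o} :=
  fun z => `[< lie_quasi_state z /\ continuous_on_coords z >].

Fact quasi_state_submod : subsemimod_closed quasi_state_pred.
Proof.
split; [split|].
- apply/asboolP; split=> [x1 x2 _ c1 c2|v]; first by rewrite !mulr0 addr0.
  exact: cst_continuous.
- move=> z1 z2 /asboolP[q1 k1] /asboolP[q2 k2]; apply/asboolP; split.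
    move=> x1 x2 h c1 c2; rewrite -[LHS]/(z1 _ + z2 _) q1// q2//.
    by rewrite -[(z1 + z2) x1]/(z1 x1 + z2 x1) -[(z1 + z2) x2]/(z1 x2 + z2 x2)
      !mulrDr addrACA.
  by move=> v; apply: continuousD; [exact: k1|exact: k2].
- move=> a z /asboolP[q k]; apply/asboolP; split.
    move=> x1 x2 h c1 c2; rewrite -[LHS]/(a * z _) q//.
    by rewrite -[(a *: z) x1]/(a * z x1) -[(a *: z) x2]/(a * z x2) mulrDr
      !(mulrCA a).
  by move=> v; apply: continuousM; [exact: cst_continuous|exact: k].
Qed.

HB.instance Definition _ := GRing.isSubmodClosed.Build R (g -> R^o)
  quasi_state_pred quasi_state_submod.

Record quasi_state := QuasiState {
  quasi_state_fun :> g -> R^o;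
  quasi_stateP : quasi_state_fun \in quasi_state_pred
}.

HB.instance Definition _ := [isSub for quasi_state_fun].
HB.instance Definition _ := gen_eqMixin quasi_state.
HB.instance Definition _ := gen_choiceMixin quasi_state.
HB.instance Definition _ := [SubChoice_isSubZmodule of quasi_state by <:].
HB.instance Definition _ := [SubZmodule_isSubLmodule of quasi_state by <:].

Lemma linear_quasi_state (f : 'Hom(g, R^o)) :
  (f : g -> R^o) \in quasi_state_pred.
Proof.
apply/asboolP; split; last exact: linear_continuous_on_coords.
by move=> x1 x2 _ c1 c2; rewrite linearD !linearZ.
Qed.

Definition dual_pred : {pred quasi_state} :=
  fun q => `[< exists f : 'Hom(g, R^o), forall x, q x = f x >].

Fact dual_submod : subsemimod_closed dual_pred.
Proof.
split; [split|].
- by apply/asboolP; exists 0 => x; rewrite lfunE.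
- move=> q1 q2 /asboolP[f1 h1] /asboolP[f2 h2]; apply/asboolP.
  by exists (f1 + f2) => x; rewrite lfunE /= -h1 -h2.
- move=> a q /asboolP[f h]; apply/asboolP.
  by exists (a *: f) => x; rewrite lfunE /= -h.
Qed.

HB.instance Definition _ := GRing.isSubmodClosed.Build R quasi_state
  dual_pred dual_submod.

Definition quasi_state_mod_dual : lmodType R := lmod_quot dual_pred.

End LieQuasiStates.

Section Symplectic.
Variables (R : fieldType) (n : nat).

Definition symp_form : 'M[R]_(n + n) := block_mx 0 1%:M (- 1%:M) 0.

(* The derivative at 1 of A |-> A^T J A, where Sp(2n, R) is {A | A^T J A = J}:
   its kernel sp_space is the tangent space of the group at 1. *)
Definition sp_map (A : 'M[R]_(n + n)) : 'M[R]_(n + n) :=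
  A^T *m symp_form + symp_form *m A.

Fact sp_map_is_linear : linear sp_map.
Proof.
move=> a A B; rewrite /sp_map linearP /= mulmxDl mulmxDr -scalemxAl -scalemxAr.
by rewrite scalerDr addrACA.
Qed.

HB.instance Definition _ := GRing.isLinear.Build R _ _ _ sp_map
  sp_map_is_linear.

Definition sp_space : {vspace 'M[R]_(n + n)} := lker (linfun sp_map).

Lemma sp_spaceP (A : 'M[R]_(n + n)) :
  reflect (A^T *m symp_form + symp_form *m A = 0) (A \in sp_space).
Proof. by rewrite memv_ker lfunE; apply: eqP. Qed.

Definition sp := subvs_of sp_space.

HB.instance Definition _ := Vector.on sp.

Definition mx_comm (A B : 'M[R]_(n + n)) := A *m B - B *m A.

Fact sp_commP (X Y : sp) : mx_comm (vsval X) (vsval Y) \in sp_space.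
Proof.
have hX := sp_spaceP _ (subvsP X); have hY := sp_spaceP _ (subvsP Y).
move: (vsval X) (vsval Y) hX hY => A B /eqP.
rewrite addr_eq0 => /eqP hA /eqP; rewrite addr_eq0 => /eqP hB.
apply/sp_spaceP; rewrite /mx_comm linearB /= !trmx_mul mulmxBl mulmxBr.
rewrite -!mulmxA hA hB !mulmxN !mulmxA hA hB !mulNmx !opprK.
by rewrite addrC subrKA subrr.
Qed.

Definition sp_bracket (X Y : sp) : sp := Subvs (sp_commP X Y).

Fact sp_bracket_linearl (Y : sp) : linear (sp_bracket^~ Y).
Proof.
move=> a X1 X2; apply: val_inj => /=; rewrite /mx_comm.
rewrite mulmxDl mulmxDr -scalemxAl -scalemxAr scalerBr.
by rewrite opprD addrACA.
Qed.

Fact sp_bracket_linearr (X : sp) : linear (sp_bracket X).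
Proof.
move=> a Y1 Y2; apply: val_inj => /=; rewrite /mx_comm.
rewrite mulmxDl mulmxDr -scalemxAl -scalemxAr scalerBr.
by rewrite opprD addrACA.
Qed.

Fact sp_bracket_alt (X : sp) : sp_bracket X X = 0.
Proof. by apply: val_inj; rewrite /= /mx_comm subrr. Qed.

Fact sp_bracket_jacobi (X Y Z : sp) :
  sp_bracket X (sp_bracket Y Z) + sp_bracket Y (sp_bracket Z X)
  + sp_bracket Z (sp_bracket X Y) = 0.
Proof.
apply: val_inj => /=; rewrite /mx_comm !mulmxBr !mulmxBl !mulmxA.
by apply/matrixP => i j; rewrite !mxE; ring.
Qed.

HB.instance Definition _ := isLieAlgebra.Build R sp
  sp_bracket_linearl sp_bracket_linearr sp_bracket_alt sp_bracket_jacobi.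

End Symplectic.

(* Main.v *)
Require Import Defs.
From HB Require Import structures.
From mathcomp Require Import all_boot all_order all_algebra.
From mathcomp Require Import separable complex.
From mathcomp Require Import ring lra.
From mathcomp Require Import all_classical all_reals all_analysis.

Set Implicit Arguments.
Unset Strict Implicit.
Unset Printing Implicit Defensive.

Import Order.TTheory GRing.Theory Num.Theory.
Import numFieldNormedType.Exports.
Import passmx.
Local Open Scope classical_set_scope.
Local Open Scope ring_scope.

(** An element [A] of sp(2n) is [J S] with [S] symmetric, acting on row vectors;
    [J S] and [J T] commute iff [S J T = T J S].

    Uniqueness. Let [z] be a continuous quasi-state, seen as a function of [S],
    and [F x = z (x^T x)]. For omega-orthogonal [x, y] the squares of [x], [y]
    commute, as do those of [x + y], [x - y], so [F] satisfies the parallelogram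
    law there. Let [E (x, y)] be the defect of this law. If the planes of
    [(x1, y1)] and [(x2, y2)] are orthogonal and [omega x2 y2 = - omega x1 y1],
    then [E (x1, y1) = - E (x2, y2)]; since [n >= 3] there is room for three
    pairwise orthogonal planes, and the sign rule forces [E = 0]. Hence [F] is a
    quadratic form, and we may subtract a linear functional so that [F = 0].
    Given a quadratic expression [q (a, b)] in a symplectic pair and a vector [c]
    orthogonal to the pair, put a copy of it on a second orthogonal plane: the
    45 degree rotation of the two planes and the growth
    [z (q + k (c y)) = o (k)] give [z (q + c y) = z q]. These shears connect all
    pairs with the same value of [omega], so that [z] vanishes on hyperbolic
    elements [a b] and is a multiple of [`|omega a b|] on elliptic elements
    [a^2 + b^2]. An element with distinct eigenvalues is a combination of
    commuting elements of these two kinds, and such elements are dense, so [z]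
    is determined by one number.

    Existence. Extend [A] to C^2n with the hermitian form [h = i omega] of
    signature (n, n). Commuting elements of sp(2n) have a common invariant
    subspace [W] of dimension [n] on which [h >= 0], and the imaginary part of
    the trace of [A] on [W] does not depend on [W]; this is the Maslov
    quasi-state. It is additive on commuting pairs because [W] may be taken in
    common, and continuous because the set of orthonormal frames is compact. *)

(** * The symplectic form *)

Section SympForm.
Variables (F : fieldType) (n : nat).
Local Notation m := (n + n)%N.
Local Notation J := (symp_form F n).

Definition omega (x y : 'rV[F]_m) : F := (x *m J *m y^T) 0 0.

Lemma tr_symp_form : J^T = - J.
Proof.
by rewrite /symp_form tr_block_mx opp_block_mx !trmx0 trmx1 linearN /= trmx1
  opprK !oppr0.
Qed.

Lemma symp_form_sqr : J *m J = - 1%:M.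
Proof.
rewrite /symp_form mulmx_block !mulmx0 !mul0mx mulmx1 mul1mx !add0r !addr0.
by rewrite scalar_mx_block opp_block_mx !oppr0.
Qed.

Lemma symp_form_unit : J \in unitmx.
Proof.
have h : J *m (- J) = 1%:M by rewrite mulmxN symp_form_sqr opprK.
by have [] := mulmx1_unit h.
Qed.

Lemma omegaE x y : x *m J *m y^T = (omega x y)%:M.
Proof. exact: mx11_scalar. Qed.

Lemma omegaDl x y w : omega (x + y) w = omega x w + omega y w.
Proof. by rewrite /omega !mulmxDl mxE. Qed.
Lemma omegaNl x w : omega (- x) w = - omega x w.
Proof. by rewrite /omega !mulNmx mxE. Qed.
Lemma omegaZl c x w : omega (c *: x) w = c * omega x w.
Proof. by rewrite /omega -!scalemxAl mxE. Qed.
Lemma omegaC x y : omega x y = - omega y x.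
Proof.
rewrite /omega.
have -> : x *m J *m y^T = (y *m J^T *m x^T)^T
  by rewrite !trmx_mul !trmxK mulmxA.
by rewrite tr_symp_form mulmxN mulNmx !mxE.
Qed.
Lemma omegaDr x y w : omega w (x + y) = omega w x + omega w y.
Proof. by rewrite omegaC omegaDl opprD -!(omegaC w). Qed.
Lemma omegaNr x w : omega w (- x) = - omega w x.
Proof. by rewrite omegaC omegaNl -(omegaC w). Qed.
Lemma omegaZr c x w : omega w (c *: x) = c * omega w x.
Proof. by rewrite omegaC omegaZl -mulrN -(omegaC w). Qed.
Lemma omega0l w : omega 0 w = 0.
Proof. by rewrite -[0](scale0r w) omegaZl mul0r. Qed.
Lemma omega0r w : omega w 0 = 0.
Proof. by rewrite omegaC omega0l oppr0. Qed.

Definition omegaDE := (omegaDl, omegaDr, omegaNl, omegaNr, omegaZl, omegaZr).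

Lemma omegaxx x : omega x x = 0.
Proof.
rewrite /omega -[x]hsubmxK /symp_form mul_row_block tr_row_mx mul_row_col.
rewrite !mulmx0 add0r addr0 mulmxN mulmx1 mulNmx mulmx1.
have -> (u v : 'rV[F]_n) : u *m v^T = v *m u^T.
  by rewrite -[LHS]trmxK trmx_mul trmxK [LHS]mx11_scalar mxE -mx11_scalar.
by rewrite addNr mxE.
Qed.

Lemma omega_nondeg x : x != 0 -> exists y, omega x y != 0.
Proof.
move=> nx; have : x *m J != 0.
  by apply: contra nx => /eqP h; rewrite -[x](mulmxK symp_form_unit) h mul0mx.
move=> /rV0Pn [i hi]; exists (delta_mx 0 i).
by rewrite /omega trmx_delta -colE mxE.
Qed.

Definition outer (x y : 'rV[F]_m) : 'M[F]_m := x^T *m y.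

Lemma tr_outer x y : (outer x y)^T = outer y x.
Proof. by rewrite /outer trmx_mul trmxK. Qed.

Lemma outer_omega x y u v :
  outer x y *m J *m outer u v = omega y u *: outer x v.
Proof.
rewrite /outer mulmxA -(mulmxA x^T) -(mulmxA x^T) omegaE.
by rewrite mul_mx_scalar scalemxAl.
Qed.

Lemma mul_outer w x y : w *m J *m outer x y = omega w x *: y.
Proof. by rewrite /outer mulmxA omegaE mul_scalar_mx. Qed.

Definition sq (x : 'rV[F]_m) : 'M[F]_m := outer x x.
Definition dot (x y : 'rV[F]_m) : 'M[F]_m := outer x y + outer y x.

Lemma tr_sq x : (sq x)^T = sq x. Proof. exact: tr_outer. Qed.
Lemma tr_dot x y : (dot x y)^T = dot x y.
Proof. by rewrite /dot linearD /= !tr_outer addrC. Qed.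

Lemma sqD x y : sq (x + y) = sq x + dot x y + sq y.
Proof. by apply/matrixP => i j; rewrite /sq /dot !mxE !big_ord1 !mxE; ring. Qed.

Lemma sqZ c x : sq (c *: x) = c ^+ 2 *: sq x.
Proof. by apply/matrixP => i j; rewrite /sq !mxE !big_ord1 !mxE; ring. Qed.

Lemma sq_para x y : sq (x + y) + sq (x - y) = 2 *: sq x + 2 *: sq y.
Proof. by apply/matrixP => i j; rewrite /sq !mxE !big_ord1 !mxE; ring. Qed.

Definition orth (S S' : 'M[F]_m) := S *m J *m S' = 0.

Lemma orthDl S S' T : orth S T -> orth S' T -> orth (S + S') T.
Proof. by rewrite /orth !mulmxDl => -> ->; rewrite addr0. Qed.
Lemma orthDr S S' T : orth T S -> orth T S' -> orth T (S + S').
Proof. by rewrite /orth mulmxDr => -> ->; rewrite addr0. Qed.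
Lemma orthZl c S T : orth S T -> orth (c *: S) T.
Proof. by rewrite /orth -!scalemxAl => ->; rewrite scaler0. Qed.
Lemma orthZr c S T : orth T S -> orth T (c *: S).
Proof. by rewrite /orth -!scalemxAr => ->; rewrite scaler0. Qed.
Lemma orth_outer x y u v : omega y u = 0 -> orth (outer x y) (outer u v).
Proof. by rewrite /orth outer_omega => ->; rewrite scale0r. Qed.

(** Transposing [S J S' = 0] gives [S' J S = 0], since [J] is antisymmetric; both products
    vanish. *)
Lemma orth_comm S S' : S^T = S -> S'^T = S' -> orth S S' ->
  S *m J *m S' = S' *m J *m S.
Proof.
rewrite /orth => hS hS' h; rewrite h; apply: oppr_inj; rewrite oppr0.
have := congr1 trmx h; rewrite trmx0 !trmx_mul hS hS' tr_symp_form.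
by rewrite mulNmx mulmxN mulmxA => <-.
Qed.

(** Otherwise the orthogonal of [X] is isotropic, so it lies in its own orthogonal [X], hence in the
    radical of [X] and in [Z]; but its rank [m - \rank X] exceeds [\rank Z]. *)
Lemma orth_pair (X Z : 'M[F]_m) :
  (forall y : 'rV_m, (y <= X)%MS -> X *m J *m y^T = 0 -> (y <= Z)%MS) ->
  (\rank X + \rank Z < m)%N ->
  exists a b, [/\ X *m J *m a^T = 0, X *m J *m b^T = 0 & omega a b = 1].
Proof.
move=> hZ hr; pose perp (A : 'M[F]_m) := kermx (J *m A^T).
have perpP A (y : 'rV_m) : reflect (A *m J *m y^T = 0) (y <= perp A)%MS.
  have e : (A *m J *m y^T)^T = - (y *m (J *m A^T)).
    by rewrite !trmx_mul trmxK tr_symp_form !mulNmx mulmxN.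
  apply: (iffP sub_kermxP) => h.
    by apply: trmx_inj; rewrite e h trmx0 oppr0.
  by apply: oppr_inj; rewrite -e h trmx0 oppr0.
have rk A : \rank (perp A) = (m - \rank A)%N.
  rewrite mxrank_ker -mxrank_tr trmx_mul trmxK tr_symp_form.
  by rewrite mulmxN mxrank_opp mxrankMfree// row_free_unit symp_form_unit.
have perp2 A : (perp (perp A) <= A)%MS.
  have h : (A <= perp (perp A))%MS.
    apply/row_subP => i; apply/perpP; apply/row_matrixP => j.
    rewrite row0 2!row_mul.
    have e : A *m J *m (row j (perp A))^T = 0 by apply/perpP; exact: row_sub.
    have : omega (row i A) (row j (perp A)) = 0.
      by rewrite /omega -!row_mul e row0 mxE.
    rewrite omegaC => /eqP; rewrite oppr_eq0 => /eqP e'.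
    by rewrite omegaE e' raddf0.
  rewrite -(mxrank_leqif_sup h) !rk subKn//; exact: rank_leq_row.
apply: contrapT => nex.
have iso a b : (a <= perp X)%MS -> (b <= perp X)%MS -> omega a b = 0.
  move=> /perpP ha /perpP hb; apply/eqP; apply: contrapT => /negP h.
  apply: nex; exists a, ((omega a b)^-1 *: b); split=> //.
    by rewrite linearZ /= -scalemxAr hb scaler0.
  by rewrite omegaZr mulVf.
have sub : (perp X <= Z)%MS.
  apply/row_subP => i; apply: hZ; last by apply/perpP; exact: row_sub.
  apply: submx_trans (perp2 X); apply/perpP; apply/row_matrixP => j.
  by rewrite row0 2!row_mul omegaE iso ?row_sub// raddf0.
have := mxrankS sub; rewrite rk leqNgt ltn_subRL.
by rewrite hr.
Qed.

Lemma addsmx_symp0 (A B : 'M[F]_m) (y : 'rV_m) :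
  (A + B)%MS *m J *m y^T = 0 -> A *m J *m y^T = 0 /\ B *m J *m y^T = 0.
Proof.
move=> h; have key (C : 'M[F]_m) : (C <= A + B)%MS -> C *m J *m y^T = 0.
  by move=> /submxP[D ->]; rewrite -!mulmxA [X in _ *m X]mulmxA h mulmx0.
by split; apply: key; rewrite ?addsmxSl ?addsmxSr.
Qed.

Lemma genmx_symp0 (x y : 'rV[F]_m) :
  <<x>>%MS *m J *m y^T = 0 -> omega x y = 0.
Proof.
move=> h; have /submxP[D e] : (x <= <<x>>)%MS by rewrite genmxE.
by rewrite /omega e -!mulmxA [X in _ *m X]mulmxA h mulmx0 mxE.
Qed.

(** The radical of the span of [a], [b], [c] lies in the line of [c], so [orth_pair] applies: the
    two ranks add up to at most 4, and [m] is at least 6. *)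
Lemma omega_pair_orth1 (a b c : 'rV[F]_m) (s : F) : (3 <= n)%N ->
  s != 0 -> omega a b = s -> omega a c = 0 -> omega b c = 0 ->
  exists a2 b2, omega a2 b2 = s /\
    [/\ omega a a2 = 0, omega a b2 = 0, omega b a2 = 0 & omega b b2 = 0] /\
    omega c a2 = 0 /\ omega c b2 = 0.
Proof.
move=> n3 s0 hab hac hbc.
have [||a2 [b2 [ha hb h]]] := @orth_pair (<<a>> + (<<b>> + <<c>>))%MS <<c>>%MS.
- move=> y /sub_addsmxP[[u v]] /= -> /addsmx_symp0[/genmx_symp0 h1].
  move=> /addsmx_symp0[/genmx_symp0 h2 _]; move: h1 h2.
  have /sub_rVP[k1 ->] : (u *m <<a>> <= a)%MS
    by rewrite (submx_trans (submxMl _ _))// genmxE.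
  have /sub_addsmxP[[u' v'] /= ->] : (v *m (<<b>> + <<c>>)%MS <= <<b>> +
    <<c>>)%MS.
    exact: submxMl.
  have /sub_rVP[k2 ->] : (u' *m <<b>> <= b)%MS
    by rewrite (submx_trans (submxMl _ _))// genmxE.
  have /sub_rVP[k3 ->] : (v' *m <<c>> <= c)%MS
    by rewrite (submx_trans (submxMl _ _))// genmxE.
  rewrite !omegaDE !omegaxx hac hbc (omegaC b a) hab !mulr0 !addr0 add0r mulrN.
  move=> /eqP; rewrite mulf_eq0 (negbTE s0) orbF => /eqP ->.
  move=> /eqP; rewrite oppr_eq0 mulf_eq0 (negbTE s0) orbF => /eqP ->.
  by rewrite !scale0r !add0r genmxE scalemx_sub.
- have r1 (x : 'rV[F]_m) : (\rank <<x>> <= 1)%N by rewrite genmxE rank_leq_row.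
  apply: (@leq_ltn_trans 4); last exact:
    (@leq_trans (3 + 3) _ _ _ (leq_add n3 n3)).
  rewrite -(addn1 3) leq_add//.
  apply: leq_trans (mxrank_adds_leqif _ _) _; rewrite (leq_add (r1 a))//.
  by apply: leq_trans (mxrank_adds_leqif _ _) _; rewrite (leq_add (r1 b)).
have [/genmx_symp0 aa /addsmx_symp0[/genmx_symp0 ba /genmx_symp0 ca]] :=
  addsmx_symp0 ha.
have [/genmx_symp0 ab /addsmx_symp0[/genmx_symp0 bb /genmx_symp0 cb]] :=
  addsmx_symp0 hb.
exists (s *: a2), b2; rewrite !omegaDE aa ba ca h !mulr0 mulr1.
by [].
Qed.

(** The span of two orthogonal symplectic planes has radical 0 and rank at most 4, which leaves room
    for a third plane as [m] is at least 6. *)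
Lemma omega_pair_orth2 (a b c d : 'rV[F]_m) (s : F) : (3 <= n)%N ->
  s != 0 -> omega a b = s -> omega c d = s ->
  [/\ omega a c = 0, omega a d = 0, omega b c = 0 & omega b d = 0] ->
  exists a2 b2, omega a2 b2 = s /\
    [/\ omega a a2 = 0, omega a b2 = 0, omega b a2 = 0 & omega b b2 = 0] /\
    [/\ omega c a2 = 0, omega c b2 = 0, omega d a2 = 0 & omega d b2 = 0].
Proof.
move=> n3 s0 hab hcd [hac had hbc hbd].
have [||a2 [b2 [ha hb h]]] :=
  @orth_pair ((<<a>> + <<b>>) + (<<c>> + << d >>))%MS 0.
- move=> y /sub_addsmxP[[u v]] /= -> /addsmx_symp0[].
  move=> /addsmx_symp0[/genmx_symp0 h1 /genmx_symp0 h2].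
  move=> /addsmx_symp0[/genmx_symp0 h3 /genmx_symp0 h4].
  have dec (p q : 'rV[F]_m) (w : 'rV[F]_m) : exists k l,
      w *m (<<p>> + <<q>>)%MS = k *: p + l *: q.
    have /sub_addsmxP[[u' v'] /= ->] : (w *m (<<p>> + <<q>>)%MS <= <<p>> +
      <<q>>)%MS.
      exact: submxMl.
    have /sub_rVP[k ->] : (u' *m <<p>> <= p)%MS
      by rewrite (submx_trans (submxMl _ _))// genmxE.
    have /sub_rVP[l ->] : (v' *m <<q>> <= q)%MS
      by rewrite (submx_trans (submxMl _ _))// genmxE.
    by exists k, l.
  have [k1 [k2 e1]] := dec a b u; have [k3 [k4 e2]] := dec c d v.
  move: h1 h2 h3 h4; rewrite e1 e2 !omegaDE !omegaxx.
  rewrite !(omegaC c a) !(omegaC d a) !(omegaC c b) !(omegaC d b).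
  rewrite (omegaC b a) (omegaC d c) hac had hbc hbd hab hcd.
  rewrite !(mulr0, oppr0, addr0, add0r, mulrN).
  do 4![move/eqP; rewrite ?oppr_eq0 mulf_eq0 (negbTE s0) orbF => /eqP ->].
  by rewrite !scale0r !addr0 sub0mx.
- have r1 (x : 'rV[F]_m) : (\rank <<x>> <= 1)%N by rewrite genmxE rank_leq_row.
  have r2 (x y : 'rV[F]_m) : (\rank (<<x>> + <<y>>)%MS <= 2)%N.
    by apply: leq_trans (mxrank_adds_leqif _ _) _; rewrite (leq_add (r1 x)).
  rewrite mxrank0 addn0; apply: (@leq_ltn_trans 4).
    by apply: leq_trans (mxrank_adds_leqif _ _) _; rewrite (leq_add (r2 a b)).
  exact: (@leq_trans (3 + 3) _ _ _ (leq_add n3 n3)).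
have [] := addsmx_symp0 ha.
move=> /addsmx_symp0[/genmx_symp0 aa /genmx_symp0 ba].
move=> /addsmx_symp0[/genmx_symp0 ca /genmx_symp0 da].
have [] := addsmx_symp0 hb.
move=> /addsmx_symp0[/genmx_symp0 ab /genmx_symp0 bb].
move=> /addsmx_symp0[/genmx_symp0 cb /genmx_symp0 db].
by exists (s *: a2), b2; rewrite !omegaDE aa ba ca da h !mulr0 mulr1.
Qed.

End SympForm.

Ltac orth_tac := rewrite /sq /dot;
  repeat first [apply: orthDl | apply: orthDr | apply: orthZl | apply: orthZr];
  apply: orth_outer; rewrite ?omegaDE.


(** * Continuity of real and matrix valued functions *)

Section RealContinuity.
Variables (R : realType) (T : topologicalType).

Lemma continuous_addr (f g : T -> R) :
  continuous f -> continuous g -> continuous (fun x => f x + g x).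
Proof.
by move=> cf cg x; exact: (@continuousD R R^o T f g x (cf x) (cg x)).
Qed.

Lemma continuous_mulr (f g : T -> R) :
  continuous f -> continuous g -> continuous (fun x => f x * g x).
Proof. by move=> cf cg x; exact: (@continuousM R T f g x (cf x) (cg x)). Qed.

Lemma continuous_sumr (I : Type) (r : seq I) (f : I -> T -> R) :
  (forall i, continuous (f i)) -> continuous (fun x => \sum_(i <- r) f i x).
Proof.
move=> cf; elim: r => [|i r IH].
  under [X in continuous X]funext do rewrite big_nil.
  exact: cst_continuous.
under [X in continuous X]funext do rewrite big_cons.
exact: continuous_addr.
Qed.

Lemma continuous_oppr (f : T -> R) :
  continuous f -> continuous (fun x => - f x).
Proof. by move=> cf x; exact: (@continuousN R R^o T f x (cf x)). Qed.

Lemma continuous_subr (f g : T -> R) :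
  continuous f -> continuous g -> continuous (fun x => f x - g x).
Proof.
by move=> cf cg x; exact: (@continuousB R R^o T f g x (cf x) (cg x)).
Qed.

Lemma continuous_mulr_cst (f : T -> R) (c : R) :
  continuous f -> continuous (fun x => f x * c).
Proof.
move=> cf x.
exact: (@continuousM R T f (fun=> c) x (cf x) (@cst_continuous _ _ c x)).
Qed.

Lemma near_continuous (f : T -> R) (A : set R) t : open A -> continuous f ->
  A (f t) -> nbhs t (fun s => A (f s)).
Proof. by move=> oA cf At; apply: (cf t A); exact: open_nbhs_nbhs. Qed.

End RealContinuity.

Section Continuity.
Variable R : realType.

Lemma continuous_mx_entries (T : topologicalType) (p q : nat)
    (f : T -> 'M[R]_(p, q)) :
  (forall i j, continuous (fun t => f t i j)) -> continuous f.
Proof.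
move=> cf A S [P hP PS].
have : \forall B \near A, forall i j, P i j (f B i j).
  apply: (@filter_forall _ _ (fun i B => forall j, P i j (f B i j))
    (nbhs A) (nbhs_filter A)) => i.
  apply: (@filter_forall _ _ (fun j B => P i j (f B i j))
    (nbhs A) (nbhs_filter A)) => j.
  exact/cf/hP.
by apply: filterS => B hB; exact: PS.
Qed.

(** The additive function [f s - s * f 1] vanishes at 1, hence at every rational, hence everywhere
    by density. *)
Lemma continuous_additive_linear (f : R -> R) :
  (forall s t, f (s + t) = f s + f t) -> continuous f ->
  forall t, f t = t * f 1.
Proof.
move=> fD cf t; apply/eqP; rewrite -subr_eq0; apply: contrapT => /negP h.
pose g s := f s - s * f 1.
have gB : zmod_morphism g.
  move=> x y; rewrite /g.
  have -> : f (x - y) = f x - f y by have := fD (x - y) y; rewrite subrK =>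
    ->; rewrite addrK.
  ring.
pose G : {additive R -> R} := HB.pack g (GRing.isZmodMorphism.Build R R g gB).
have g1 : G 1 = 0 by rewrite /= /g mul1r subrr.
have cg : continuous g.
  apply: continuous_subr => //.
  by apply: (@continuous_mulr_cst R R id) => x; exact: cvg_id.
have [||x [/= nq [q _ qx]]] := @dense_rat R (g @^-1` [set~ 0]) _ _.
- by exists t; exact/eqP.
- apply: open_comp; first by move=> x _; exact: cg.
  exact/closed_openC/closed_eq.
apply: nq; rewrite -qx.
have : G (ratr q *~ denq q) = 0.
  rewrite -[_ *~ _]mulrzr /= -ratr_int -rmorphM /= -numqE ratr_int.
  by rewrite -[X in g X]/(1 *~ numq q) -[g]/(G : R -> R) raddfMz g1 mul0rz.
rewrite raddfMz => /eqP; rewrite -mulrzr mulf_eq0 intr_eq0.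
by rewrite (negbTE (denq_neq0 q)) orbF => /eqP.
Qed.

(** The Jordan-von Neumann argument: the polarization [D] is biadditive, and continuity along lines
    makes it bilinear. [G] is its Gram matrix on the standard basis. *)
Lemma quadratic_of_parallelogram (p : nat) (F : 'rV[R]_p -> R) :
  (forall x y, continuous (fun t : R => F (t *: x + y))) ->
  (forall x y, F (x + y) + F (x - y) = 2 * F x + 2 * F y) ->
  exists G : 'M[R]_p, forall x, F x = \tr (x^T *m x *m G).
Proof.
move=> cF para; have F0 : F 0 = 0.
  by have := para 0 0; rewrite addr0 subr0; lra.
have FN x : F (- x) = F x by have := para 0 x; rewrite add0r sub0r F0; lra.
pose D x y := (F (x + y) - F (x - y)) / 4.
(* Difference of the parallelogram laws at [(x + y, x' + y)] and at [(x - y, x' - y)]. *)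
have D_half x x' y : D x y + D x' y = D (x + x') (y + y) / 2.
  have h1 := para (x + y) (x' + y); have h2 := para (x - y) (x' - y).
  have e1 : x + y + (x' + y) = x + x' + (y + y) by rewrite addrACA.
  have e2 : x - y + (x' - y) = x + x' - (y + y).
    by rewrite addrACA opprD.
  have e3 : x + y - (x' + y) = x - x' by rewrite opprD addrACA subrr addr0.
  have e4 : x - y - (x' - y) = x - x'.
    by rewrite opprB subrKA.
  rewrite e1 e3 in h1; rewrite e2 e4 in h2.
  by rewrite /D; lra.
have D0 y : D 0 y = 0 by rewrite /D add0r sub0r FN subrr mul0r.
have Dl x x' y : D (x + x') y = D x y + D x' y.
  have := D_half (x + x') 0 y; rewrite D0 addr0 addr0 => ->.
  by rewrite D_half.
have DC x y : D x y = D y x by rewrite /D (addrC y) -(FN (y - x)) opprB.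
have Dr x y y' : D x (y + y') = D x y + D x y' by rewrite DC Dl !(DC _ x).
have Dxx x : D x x = F x.
  by rewrite /D subrr F0; have := para x x; rewrite subrr F0; lra.
have Dc x y : continuous (fun t : R => D (t *: x) y).
  by apply: continuous_mulr_cst; apply: continuous_subr; exact: cF.
have DZ t x y : D (t *: x) y = t * D x y.
  rewrite (@continuous_additive_linear (fun s => D (s *: x) y))// ?scale1r//.
  by move=> a b; rewrite scalerDl Dl.
have Dsum I (r : seq I) (f : I -> 'rV[R]_p) y :
    D (\sum_(i <- r) f i) y = \sum_(i <- r) D (f i) y.
  by elim/big_rec2: _ => [|i u v _ <-]; rewrite ?D0 ?Dl.
exists (\matrix_(i, j) D (delta_mx 0 i) (delta_mx 0 j)) => x.
rewrite -Dxx {1}[x]row_sum_delta Dsum mxtrace_mulC.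
have -> : \matrix_(i, j) D (delta_mx 0 i) (delta_mx 0 j) *m (x^T *m x) =
  (\col_i D (delta_mx 0 i) x) *m x.
  rewrite mulmxA; congr (_ *m x); apply/colP => i; rewrite !mxE.
  rewrite [x in RHS]row_sum_delta DC Dsum; apply: eq_bigr => j _.
  by rewrite !mxE DZ DC mulrC.
rewrite mxtrace_mulC trace_mx11 mxE; apply: eq_bigr => i _.
by rewrite DZ mxE.
Qed.

End Continuity.

(** * Squares of vectors *)

Section SymQuasi.
Variables (R : realType) (n : nat).
Local Notation m := (n + n)%N.
Local Notation J := (symp_form R n).
Local Notation omega := (@omega R n).
Local Notation outer := (@outer R n).

(** A continuous quasi-state read through [S -> J S]: the last condition on [S] and [T] says that
    [J S] and [J T] commute. Off the symmetric matrices only continuity is asked. *)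
Definition sym_quasi (z : 'M[R]_m -> R) := continuous z /\
  forall S T : 'M[R]_m, S^T = S -> T^T = T -> S *m J *m T = T *m J *m S ->
  forall c d, z (c *: S + d *: T) = c * z S + d * z T.

Local Notation sq := (@sq R n).
Local Notation dot := (@dot R n).

Lemma dot_sqB (x y : 'rV[R]_m) : dot x y = 2^-1 *: sq (x + y) + (- 2^-1) *:
  sq (x - y).
Proof.
by apply/matrixP => i j; rewrite /sq /dot !mxE !big_ord1 !mxE; field.
Qed.

Section Fixed.
Variable z : 'M[R]_m -> R.
Hypothesis zq : sym_quasi z.

Lemma sym_quasiZ c S : S^T = S -> z (c *: S) = c * z S.
Proof.
move=> hS; have := zq.2 S S hS hS erefl c 0.
by rewrite scale0r addr0 mul0r addr0.
Qed.

Lemma sym_quasi_orth S S' : S^T = S -> S'^T = S' -> orth S S' ->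
  z (S + S') = z S + z S'.
Proof.
move=> hS hS' h; have := zq.2 S S' hS hS' (orth_comm hS hS' h) 1 1.
by rewrite !scale1r !mul1r.
Qed.

Lemma sym_quasi_path (A B C : 'M[R]_m) :
  continuous (fun t : R => z (t ^+ 2 *: A + t *: B + C)).
Proof.
move=> t; apply: (@continuous_comp _ _ _
  (fun t : R => t ^+ 2 *: A + t *: B + C) z); last exact: zq.1.
apply: continuous_mx_entries => i j u.
under [X in continuous_at _ X]funext do rewrite !mxE.
apply: (@continuousD R R^o R (fun x => x ^+ 2 * A i j + x * B i j)
  (fun=> C i j)); last exact: cst_continuous.
apply: (@continuousD R R^o R (fun x => x ^+ 2 * A i j) (fun x => x * B i j)).
  by apply: continuous_mulr_cst; exact: exprn_continuous.
by apply: (@continuous_mulr_cst R R id) => v; exact: cvg_id.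
Qed.

Lemma sym_quasi_line (B C : 'M[R]_m) :
  continuous (fun t : R => z (t *: B + C)).
Proof.
move=> t; have := @sym_quasi_path 0 B C t.
by under [X in continuous_at _ X]funext do rewrite scaler0 add0r.
Qed.

Lemma sq_para_omega0 x y : omega x y = 0 ->
  z (sq (x + y)) + z (sq (x - y)) = 2 * z (sq x) + 2 * z (sq y).
Proof.
move=> h; have h' : omega y x = 0 by rewrite omegaC h oppr0.
rewrite -!sym_quasiZ ?tr_sq// -!sym_quasi_orth ?sq_para//.
all: try by rewrite ?linearZ /= tr_sq.
all: by orth_tac; rewrite ?h ?h' ?omegaxx; lra.
Qed.

(* Apply the law to [(x1 + x2, y1 + y2)] and to [(x1 - x2, y1 - y2)], which are
   omega-orthogonal, and add: the mixed squares cancel. *)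
Lemma sq_para_planes x1 y1 x2 y2 : omega x1 y1 + omega x2 y2 = 0 ->
  [/\ omega x1 x2 = 0, omega x1 y2 = 0, omega y1 x2 = 0 & omega y1 y2 = 0] ->
  z (sq (x1 + y1)) + z (sq (x1 - y1)) - 2 * z (sq x1) - 2 * z (sq y1) =
  - (z (sq (x2 + y2)) + z (sq (x2 - y2)) - 2 * z (sq x2) - 2 * z (sq y2)).
Proof.
move=> h [hxx hxy hyx hyy].
have hyx' : omega x2 y1 = 0 by rewrite omegaC hyx oppr0.
have h1 := @sq_para_omega0 (x1 + x2) (y1 + y2).
have h2 := @sq_para_omega0 (x1 - x2) (y1 - y2).
have h3 := @sq_para_omega0 (x1 + y1) (x2 + y2).
have h4 := @sq_para_omega0 (x1 - y1) (x2 - y2).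
have h5 := @sq_para_omega0 x1 x2 hxx.
have h6 := @sq_para_omega0 y1 y2 hyy.
have e1 : x1 - x2 + (y1 - y2) = x1 + y1 - (x2 + y2) by rewrite opprD addrACA.
have e2 : x1 - x2 - (y1 - y2) = x1 - y1 - (x2 - y2).
  by rewrite !opprD !opprK addrACA.
have e3 : x1 + x2 - (y1 + y2) = x1 - y1 + (x2 - y2) by rewrite opprD addrACA.
have e4 : x1 + x2 + (y1 + y2) = x1 + y1 + (x2 + y2) by rewrite addrACA.
rewrite !omegaDE hxy hyx' in h1 h2.
rewrite !omegaDE hxx hxy hyx hyy in h3 h4.
rewrite e4 e3 in h1; rewrite e1 e2 in h2.
move: (h1 ltac:(lra)) (h2 ltac:(lra)) (h3 ltac:(lra)) (h4 ltac:(lra)) h5 h6.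
lra.
Qed.

Hypothesis n3 : (3 <= n)%N.

(** On three pairwise orthogonal planes the defects satisfy [E1 = - E2], [E2 = - E3] and
    [E1 = - E3], which leaves only 0. *)
Lemma sq_para_all x y :
  z (sq (x + y)) + z (sq (x - y)) = 2 * z (sq x) + 2 * z (sq y).
Proof.
have [|s0] := eqVneq (omega x y) 0; first exact: sq_para_omega0.
have [||x2 [y2 [e2 [r12 _]]]] :=
  omega_pair_orth1 (c := 0) n3 s0 erefl; rewrite ?omega0r//.
have [x3 [y3 [e3 [r13 r23]]]] :=
  omega_pair_orth2 n3 s0 erefl e2 r12.
have sqN u : z (sq (- u)) = z (sq u).
  by congr z; rewrite -scaleN1r sqZ sqrrN expr1n scale1r.
case: r12 r13 r23 => c1 c2 c3 c4 [a1 a2 a3 a4] [b1 b2 b3 b4].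
(* Negating the second vector turns equal values of [omega] into opposite ones and leaves the defect
   unchanged. *)
have h1 := @sq_para_planes x y x2 (- y2).
have h2 := @sq_para_planes x2 y2 x3 (- y3).
have h3 := @sq_para_planes x y x3 (- y3).
rewrite !omegaNr ?opprK ?sqN in h1 h2 h3.
move: (h1 ltac:(lra) ltac:(split; lra)) (h2 ltac:(lra) ltac:(split; lra))
  (h3 ltac:(lra) ltac:(split; lra)); lra.
Qed.

Lemma sq_linear_part : exists G : 'M[R]_m, forall x, z (sq x) = \tr (sq x *m G).
Proof.
apply: (@quadratic_of_parallelogram R m (fun x => z (sq x))).
  move=> x y t; have := @sym_quasi_path (sq x) (dot x y) (sq y) t.
  congr (continuous_at _ _); apply/funext => u; congr z.
  rewrite sqD sqZ; congr (_ + _ + _).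
  by apply/matrixP => i j; rewrite /dot !mxE !big_ord1 !mxE; ring.
exact: sq_para_all.
Qed.

End Fixed.

Lemma sym_quasiB_linear z (G : 'M[R]_m) :
  sym_quasi z -> sym_quasi (fun S => z S - \tr (S *m G)).
Proof.
move=> [cz hz]; split; last first.
  move=> S S' hS hS' h c c'; rewrite hz// mulmxDl -!scalemxAl.
  by rewrite mxtraceD !mxtraceZ; ring.
apply: continuous_subr => //.
(* The trace is viewed as a linear map into 1 by 1 matrices, to obtain its continuity from
   [linear_mx_continuous]. *)
pose f (S : 'M[R]_m) : 'M[R]_1 := (\tr (S *m G))%:M.
have fl : linear f.
  move=> a S T; rewrite /f mulmxDl -scalemxAl mxtraceD mxtraceZ.
  by rewrite raddfD /= scale_scalar_mx.
pose L : {linear 'M[R]_m -> 'M[R]_1} :=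
  HB.pack f (GRing.isLinear.Build R _ _ _ f fl).
have -> : (fun S => \tr (S *m G)) = (fun S => L S 0 0).
  by apply/funext => S; rewrite /= /f mxE eqxx.
move=> S; apply: (@continuous_comp _ _ _ L (fun w : 'M[R]_1 => w 0 0)).
  exact: linear_mx_continuous.
exact: coord_continuous.
Qed.

(** The bound passes to the limit [p 0], since the powers of one half tend to 0. *)
Lemma lim_halves (p : R -> R) (c : R) : continuous p -> p 0 = 0 ->
  (forall k, `|c| <= `|p (2^-1 ^+ k)|) -> c = 0.
Proof.
move=> cp p0 hc; apply/eqP; rewrite -normr_eq0.
have c2 : (fun k => (2^-1 : R) ^+ k) @ \oo --> (0 : R).
  by apply: cvg_expr; rewrite ger0_norm ?invr_ge0// invf_lt1// ltr1n.
have cv : (fun k => `|p (2^-1 ^+ k)|) @ \oo --> `|p 0|.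
  exact: (@cvg_norm _ R^o _ _ _ _ _ (@cvg_comp _ _ _ _ p _ _ _ c2 (cp 0))).
rewrite eq_le normr_ge0 andbT -(normr0 R) -p0 -(cvg_lim _ cv)//.
apply: limr_ge; first by apply/cvg_ex; exists `|p 0|.
exact: nearW.
Qed.

End SymQuasi.

(** * Quasi-states vanishing on squares *)

Section SquareVanishing.
Variables (R : realType) (n : nat).
Local Notation m := (n + n)%N.
Local Notation J := (symp_form R n).
Local Notation omega := (@omega R n).
Local Notation outer := (@outer R n).
Local Notation sq := (@sq R n).
Local Notation dot := (@dot R n).

Definition qform (u v w : R) a b := u *: sq a + v *: dot a b + w *: sq b.

Lemma tr_qform u v w a b : (qform u v w a b)^T = qform u v w a b.
Proof. by rewrite /qform 2!raddfD /= !linearZ /= !tr_sq tr_dot. Qed.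

Lemma qformC u v w a b : qform u v w a b = qform w v u b a.
Proof. by rewrite /qform addrC (addrC (u *:
  _)) addrA /dot (addrC (outer b a)). Qed.

Variable z : 'M[R]_m -> R.
Hypothesis zq : sym_quasi z.
Hypothesis z0 : forall x, z (sq x) = 0.
Hypothesis n3 : (3 <= n)%N.

(** Polarization: [dot x y] is half the difference of the squares of [x + y] and [x - y], which
    commute here. *)
Lemma dot_orth_vanish x y : omega x y = 0 -> z (dot x y) = 0.
Proof.
move=> h; have h' : omega y x = 0 by rewrite omegaC h oppr0.
rewrite dot_sqB zq.2 ?tr_sq// ?z0 ?mulr0 ?addr0//.
apply: orth_comm; rewrite ?tr_sq//.
by orth_tac; rewrite h h' !omegaxx; lra.
Qed.

Section Shear.
Variables (u v w : R) (c : 'rV[R]_m).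
Local Notation q := (qform u v w).
Local Notation y a b := (u *: a + v *: b).

(** Up to the term [(k ^+ 2 * u) *: sq c], the argument of [z] is [q (a + k *: c) b]. *)
Definition sheared k a b : R := z (q a b + k *: dot c (y a b)).

Lemma sheared_sym k a b :
  (q a b + k *: dot c (y a b))^T = q a b + k *: dot c (y a b).
Proof. by rewrite raddfD /= linearZ /= tr_dot tr_qform. Qed.

(** The 45 degree rotation of two planes. The terms on the left commute since the planes are
    orthogonal to each other and to [c], those on the right because moreover the two values of
    [omega] agree; both sides are [z] of the same matrix. *)
Lemma sheared_split a1 b1 a2 b2 k l :
  omega c a1 = 0 -> omega c b1 = 0 -> omega c a2 = 0 -> omega c b2 = 0 ->
  [/\ omega a1 a2 = 0, omega a1 b2 = 0, omega b1 a2 = 0 & omega b1 b2 = 0] ->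
  omega a1 b1 = omega a2 b2 ->
  sheared k a1 b1 + sheared l a2 b2 =
  2^-1 * (sheared (k + l) (a1 + a2) (b1 + b2) +
          sheared (k - l) (a1 - a2) (b1 - b2)).
Proof.
move=> ca1 cb1 ca2 cb2 [haa hab hba hbb] hs; rewrite /sheared.
have C x y : omega x y = 0 -> omega y x = 0 by move=> h; rewrite omegaC h oppr0.
have s12 : omega b1 a1 = omega b2 a2 by rewrite omegaC hs -omegaC.
rewrite mulrDr -!(sym_quasiZ zq).
- rewrite -!(sym_quasi_orth zq).
  + congr z; apply/matrixP => i j.
    by rewrite /qform /sq /dot !mxE !big_ord1 !mxE; field.
  all: try by rewrite ?linearZ /= ?sheared_sym.
  all: by rewrite /qform; orth_tac;
    rewrite ?(ca1, cb1, ca2, cb2, C _ _ ca1, C _ _ cb1, C _ _ ca2, C _ _ cb2);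
    rewrite ?(haa, hab, hba, hbb, C _ _ haa, C _ _ hab, C _ _ hba, C _ _ hbb);
    rewrite ?omegaxx ?hs ?s12; lra.
all: by rewrite sheared_sym.
Qed.

(** At the arguments [(2 k, 0)], [(k, k)], [(k, - k)] and [(0, 0)] the functions [P] and [M] are
    taken only at 0 and [2 k], and can be eliminated. *)
Lemma pexider_double (A1 A2 P M : R -> R) (k : R) :
  (forall x y, A1 x + A2 y = 2^-1 * (P (x + y) + M (x - y))) ->
  A1 (2 * k) - A1 0 = 2 * (A1 k - A1 0) + (A2 k - A2 0) + (A2 (- k) - A2 0).
Proof.
move=> S; have := S (2 * k) 0; have := S k k; have := S k (- k).
have := S 0 0; rewrite opprK !addr0 !subr0 !subrr mulrDl mul1r; lra.
Qed.

(* [f k + d * f (- k)] is [o (k)] because [z (A / k + D)] tends to [z D = 0]; so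
   it cannot grow at least linearly along [2 ^ j * k]. With [d = 1] and [d = 0]
   this treats the even part of [f] and [f] itself. *)
Lemma sublinear_vanish (A D : 'M[R]_m) (f : R -> R) (d k : R) :
  A^T = A -> D^T = D -> z D = 0 -> (forall t, f t = z (A + t *: D) - z A) ->
  (forall j, 2 ^+ j * `|f k + d * f (- k)| <=
    `|f (2 ^+ j * k) + d * f (- (2 ^+ j * k))|) ->
  f k + d * f (- k) = 0.
Proof.
move=> hA hD zD hf hk.
pose p t := (z (t *: A + k *: D) - t * z A) +
  d * (z (t *: A + (- k) *: D) - t * z A).
apply: (@lim_halves R p).
- have cA l : continuous (fun t : R => z (t *: A + l *: D) - t * z A).
    apply: continuous_subr; first exact: sym_quasi_line.
    by apply: (@continuous_mulr_cst R R id) => t; exact: cvg_id.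
  move=> t; apply: (@continuousD R R^o R
    (fun t => z (t *: A + k *: D) - t * z A)); first exact: cA.
  have -> : (fun t => d * (z (t *: A + (- k) *: D) - t * z A)) =
    (fun t => (z (t *: A + (- k) *: D) - t * z A) * d).
    by apply/funext => x; rewrite mulrC.
  by apply: continuous_mulr_cst; exact: cA.
- by rewrite /p !scale0r !add0r !(sym_quasiZ zq)// zD !(mulr0, mul0r, subr0,
    addr0).
move=> j; have e0 : (2 : R) ^+ j != 0 by rewrite expf_neq0.
have e l : z (2^-1 ^+ j *: A + l *: D) - 2^-1 ^+ j * z A =
    2^-1 ^+ j * f (2 ^+ j * l).
  rewrite hf mulrBr; congr (_ - _).
  have hs : (A + (2 ^+ j * l) *: D)^T = A + (2 ^+ j * l) *: D.
    by rewrite raddfD /= linearZ /= hA hD.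
  by rewrite -(sym_quasiZ zq)// scalerDr scalerA mulrA exprVn mulVf// mul1r.
rewrite /p !e mulrN mulrCA -mulrDr normrM.
rewrite ger0_norm ?exprn_ge0 ?invr_ge0// exprVn.
by rewrite ler_pdivlMl ?exprn_gt0.
Qed.

(** Doubling [k] multiplies the even part of the increment [f1] by 4, which sublinear growth
    excludes unless it is 0. Then doubling multiplies [f1] itself by 2, which is excluded in the
    same way. *)
Lemma shear_invariant a b s : s != 0 -> omega a b = s ->
  omega c a = 0 -> omega c b = 0 ->
  z (q a b + dot c (y a b)) = z (q a b).
Proof.
move=> s0 hab ca cb.
have ac : omega a c = 0 by rewrite omegaC ca oppr0.
have bc : omega b c = 0 by rewrite omegaC cb oppr0.
have [a2 [b2 [h2 [hp [ca2 cb2]]]]] := omega_pair_orth1 n3 s0 hab ac bc.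
have hp' : [/\ omega a2 a = 0, omega a2 b = 0, omega b2 a = 0 & omega b2 b = 0].
  by case: hp => p1 p2 p3 p4; split; rewrite omegaC ?p1 ?p2 ?p3 ?p4 oppr0.
pose f1 k := sheared k a b - sheared 0 a b.
pose f2 k := sheared k a2 b2 - sheared 0 a2 b2.
have dbl1 k : f1 (2 * k) = 2 * f1 k + f2 k + f2 (- k).
  apply: (@pexider_double (fun k => sheared k a b)
    (fun k => sheared k a2 b2) (fun k => sheared k (a + a2) (b + b2))
    (fun k => sheared k (a - a2) (b - b2))) => x y.
  apply: sheared_split => //.
  by rewrite hab h2.
have dbl2 k : f2 (2 * k) = 2 * f2 k + f1 k + f1 (- k).
  apply: (@pexider_double (fun k => sheared k a2 b2)
    (fun k => sheared k a b) (fun k => sheared k (a2 + a) (b2 + b))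
    (fun k => sheared k (a2 - a) (b2 - b))) => x y.
  apply: sheared_split => //.
  by rewrite hab h2.
(* At [2 * (k / 2)] both doubling rules give twice the sum of the two even parts at [k / 2]. *)
have e12 k : f1 k + f1 (- k) = f2 k + f2 (- k).
  have -> : k = 2 * (k / 2) by rewrite mulrC divfK.
  by rewrite -mulrN !dbl1 !dbl2 opprK; lra.
have e4 k j : f1 (2 ^+ j * k) + f1 (- (2 ^+ j * k)) =
    4 ^+ j * (f1 k + f1 (- k)).
  elim: j => [|j IH]; first by rewrite !expr0 !mul1r.
  rewrite !exprS -!mulrA -IH -mulrN !dbl1 opprK.
  by have := e12 (2 ^+ j * k); lra.
have sub d k : (forall j, 2 ^+ j * `|f1 k + d * f1 (- k)| <=
    `|f1 (2 ^+ j * k) + d * f1 (- (2 ^+ j * k))|) ->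
    f1 k + d * f1 (- k) = 0.
  apply: (@sublinear_vanish (q a b) (dot c (y a b))).
  - exact: tr_qform.
  - exact: tr_dot.
  - by apply: dot_orth_vanish; rewrite omegaDr !omegaZr ca cb !mulr0 addr0.
  - by move=> t; rewrite /f1 /sheared scale0r addr0.
have even k : f1 k + f1 (- k) = 0.
  rewrite -[X in _ + X]mul1r; apply: sub => j; rewrite !mul1r e4 normrM.
  rewrite ler_wpM2r// ger0_norm ?exprn_ge0//.
  by rewrite lerXn2r ?nnegrE// ler_nat.
have odd k : f1 k = 0.
  have := sub 0 k; rewrite !mul0r !addr0; apply=> j; rewrite mul0r addr0.
  suff -> : f1 (2 ^+ j * k) = 2 ^+ j * f1 k.
    by rewrite normrM ger0_norm// exprn_ge0.
  elim: j => [|j IH]; first by rewrite !expr0 !mul1r.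
  rewrite !exprS -!mulrA -IH dbl1.
  by have := e12 (2 ^+ j * k); have := even (2 ^+ j * k); lra.
have := odd 1; rewrite /f1 /sheared scale1r scale0r addr0.
by move/eqP; rewrite subr_eq0 => /eqP.
Qed.

End Shear.

Section Pairs.
Variables u v w : R.
Local Notation Q a b := (z (qform u v w a b)).

(** The difference from the sheared expression is a multiple of [sq c], which is orthogonal to it
    and on which [z] vanishes. *)
Lemma qform_addl a b c : omega a b != 0 -> omega c a = 0 -> omega c b = 0 ->
  Q (a + c) b = Q a b.
Proof.
move=> s0 ca cb; rewrite -(shear_invariant u v w s0 erefl ca cb).
have -> : qform u v w (a + c) b =
    qform u v w a b + dot c (u *: a + v *: b) + u *: sq c.
  by apply/matrixP => i j; rewrite /qform /sq /dot !mxE !big_ord1 !mxE; ring.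
rewrite (sym_quasi_orth zq).
- by rewrite (sym_quasiZ zq) ?tr_sq// z0 mulr0 addr0.
- by rewrite raddfD /= tr_dot tr_qform.
- by rewrite linearZ /= tr_sq.
have ac : omega a c = 0 by rewrite omegaC ca oppr0.
have bc : omega b c = 0 by rewrite omegaC cb oppr0.
by rewrite /qform; orth_tac; rewrite ?ac ?bc ?ca ?cb ?omegaxx; lra.
Qed.

End Pairs.

Section Pairs2.
Variables u v w : R.
Local Notation Q a b := (z (qform u v w a b)).

Lemma qform_addr a b c : omega a b != 0 -> omega c a = 0 -> omega c b = 0 ->
  Q a (b + c) = Q a b.
Proof.
move=> s0 ca cb; rewrite !(qformC u v w) qform_addl//.
by rewrite omegaC oppr_eq0.
Qed.

(** Chain [(a, b)], [(a + a2, b)], [(a + a2, b2)], [(a2, b2)]: each step changes one vector by a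
    vector orthogonal to the pair. *)
Lemma qform_orth_pairs a b a2 b2 : omega a b != 0 -> omega a2 b2 = omega a b ->
  [/\ omega a a2 = 0, omega a b2 = 0, omega b a2 = 0 & omega b b2 = 0] ->
  Q a b = Q a2 b2.
Proof.
move=> s0 h [aa ab ba bb].
have C x x' : omega x x' = 0 -> omega x' x = 0 by move=> e;
  rewrite omegaC e oppr0.
have ha : omega b2 a2 = - omega a b by rewrite omegaC h.
have e1 : Q (a + a2) b = Q a b.
  by apply: qform_addl => //; rewrite C.
have e2 : Q (a + a2) (b + (b2 - b)) = Q (a + a2) b.
  apply: qform_addr; rewrite ?omegaDE ?omegaxx ?(C _ _ ab) ?(C _ _ bb) ?ha.
  - by rewrite (C _ _ ba) addr0.
  - by rewrite ba (omegaC b a); lra.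
  - lra.
have e3 : Q (a2 + a) b2 = Q a2 b2.
  by apply: qform_addl; rewrite ?h ?aa ?ab.
by rewrite -e1 -e2 -e3 /= addrC (addrC b) subrK.
Qed.

(** A multiple of [a] may be added to [b], since [(a, b)] and [(a, b + k *: a)] compare with the
    same pair on an orthogonal plane. What remains of [b' - b] is a shear. *)
Lemma qform_changer a b b' : omega a b != 0 -> omega a b' = omega a b ->
  Q a b' = Q a b.
Proof.
move=> s0 h; set s := omega a b in s0 h.
have [||a2 [b2 [e2 [[aa ab ba bb] _]]]] :=
  omega_pair_orth1 (c := 0) n3 s0 (erefl s); rewrite ?omega0r//.
(* This value makes [b' - b - k *: a] orthogonal to [b + k *: a]; it is orthogonal to [a] for every
   [k]. *)
pose k := omega b' b / s.
have hk : Q a (b + k *: a) = Q a b.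
  rewrite (@qform_orth_pairs a b a2 b2)//.
  apply: qform_orth_pairs => //.
  - by rewrite omegaDr omegaZr omegaxx mulr0 addr0.
  - by rewrite e2 omegaDr omegaZr omegaxx mulr0 addr0.
  - by rewrite !omegaDl !omegaZl aa ab ba bb !mulr0 !addr0.
rewrite -hk; have -> : b' = b + k *: a + (b' - b - k *: a).
  by rewrite -(addrA b') -opprD [RHS]addrC subrK.
apply: qform_addr.
- by rewrite omegaDr omegaZr omegaxx mulr0 addr0.
- rewrite !omegaDE omegaxx (omegaC b' a) h (omegaC b a) -/s; lra.
- rewrite !omegaDE !omegaxx (omegaC b' a) h (omegaC b a) -/s.
  have -> : k * s = omega b' b by rewrite divfK.
  have : k * s = omega b' b by rewrite divfK.
  lra.
Qed.

End Pairs2.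

Section Pairs3.
Variables u v w : R.
Local Notation Q a b := (z (qform u v w a b)).

Lemma qform_changel a b a' : omega a b != 0 -> omega a' b = omega a b ->
  Q a' b = Q a b.
Proof.
move=> s0 h; rewrite /= !(qformC u v w); apply: qform_changer.
  by rewrite omegaC oppr_eq0.
by rewrite !(omegaC b) h.
Qed.

(** When [omega x x'] is nonzero, some [d] pairs with both [x] and [x'] to the common value, and the
    pairs [(x, d)] and [(x', d)] connect the given ones by changes of a single vector. *)
Lemma qform_pairs a b a' b' : omega a b != 0 -> omega a' b' = omega a b ->
  Q a b = Q a' b'.
Proof.
have key x y x' y' : omega x y != 0 -> omega x' y' = omega x y ->
    omega x x' != 0 -> Q x y = Q x' y'.
  move=> s0 h t0; pose d := omega x y / omega x x' *: (x' - x).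
  have d1 : omega x d = omega x y.
    by rewrite omegaZr omegaDr omegaNr omegaxx subr0 divfK.
  have d2 : omega x' d = omega x y.
    by rewrite omegaZr omegaDr omegaNr omegaxx add0r -(omegaC x x') divfK.
  rewrite -(@qform_changer u v w x y d)//.
  rewrite -(@qform_changel x d x') ?d1//.
  by apply: esym; rewrite /= -(@qform_changer u v w x' y' d)// ?h ?d2.
move=> s0 h.
(* In general an intermediate pair [(t, r)] is used; one of [b], [b'] and [b + b'] always qualifies
   as [t]. *)
have via t : omega a t != 0 -> omega a' t != 0 -> Q a b = Q a' b'.
  move=> h1 h2; have [r hr] : exists r, omega t r = omega a b.
    exists ((omega a b / omega a t) *: (- a)).
    by rewrite omegaZr omegaNr -omegaC divfK.
  rewrite (key _ _ t r)//; apply: key; rewrite ?hr//.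
  by rewrite omegaC oppr_eq0.
have [h2|h2] := eqVneq (omega a' b) 0; last exact: (via b).
have [h1|h1] := eqVneq (omega a b') 0; last by apply: (via b'); rewrite ?h.
by apply: (via (b + b')); rewrite omegaDr ?h1 ?h2 ?h ?addr0 ?add0r.
Qed.

End Pairs3.

(** The pair [(b, - a)] has the same value of [omega], and [dot b (- a) = - dot a b]; so [z] equals
    its own opposite. *)
Lemma dot_vanish a b : z (dot a b) = 0.
Proof.
have [|s0] := eqVneq (omega a b) 0; first exact: dot_orth_vanish.
have := @qform_pairs 0 1 0 a b b (- a) s0 _.
rewrite omegaNr -omegaC /= => /(_ erefl).
rewrite /qform !scale0r !add0r !addr0 !scale1r.
have -> : dot b (- a) = (-1) *: dot a b.
  by apply/matrixP => i j; rewrite /dot !mxE !big_ord1 !mxE; ring.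
by rewrite (sym_quasiZ zq) ?tr_dot//; lra.
Qed.

(** For [omega a b] positive, dividing both vectors by its square root reduces to [(e, f)]; for a
    negative value the vectors are exchanged. *)
Lemma sqD_vanish e f : omega e f = 1 -> z (sq e + sq f) = 0 ->
  forall a b, z (sq a + sq b) = 0.
Proof.
move=> ef h0.
have pos a b : 0 < omega a b -> z (sq a + sq b) = 0.
  move=> s0; set s := omega a b in s0.
  have h1 : omega ((Num.sqrt s)^-1 *: a) ((Num.sqrt s)^-1 *: b) = 1.
    rewrite omegaZl omegaZr mulrA -invfM -expr2 sqr_sqrtr ?ltW//.
    by rewrite mulVf// gt_eqF.
  have := @qform_pairs 1 0 1 _ _ _ _ _ (etrans h1 (esym ef)).
  rewrite ef => /(_ (oner_neq0 _)).
  rewrite /qform !scale0r !addr0 !scale1r h0.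
  rewrite !sqZ -scalerDr (sym_quasiZ zq) ?exprVn ?sqr_sqrtr ?ltW//; last first.
    by rewrite raddfD /= !tr_sq.
  by move/esym/eqP; rewrite mulf_eq0 invr_eq0 gt_eqF//= => /eqP.
move=> a b; have [s0|s0|s0] := ltgtP (omega a b) 0; last 2 first.
- exact: pos.
- have s1 : omega b a = 0 by rewrite omegaC s0 oppr0.
  rewrite (sym_quasi_orth zq) ?tr_sq// ?z0 ?addr0//.
  by orth_tac.
by rewrite addrC; apply: pos; rewrite omegaC oppr_gt0.
Qed.

End SquareVanishing.

(** * Elements with distinct eigenvalues *)

(** The [p] roots are distinct and the sum of their eigenspaces is direct, so any choice of
    eigenvectors is a basis. *)
Lemma separable_eigenbasis (F : closedFieldType) (p : nat) (A : 'M[F]_p) :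
  separable_poly (char_poly A) ->
  exists (P : 'M[F]_p) (l : 'I_p -> F),
    [/\ P \in unitmx, injective l & forall i, row i P *m A = l i *: row i P].
Proof.
move=> sep; have [rs ers] := closed_field_poly_normal (char_poly A).
move: ers; rewrite (monicP (char_poly_monic A)) scale1r => ers.
have szrs : size rs = p.
  by apply: succn_inj; rewrite -(size_char_poly A) ers size_prod_XsubC.
have urs : uniq rs by rewrite -separable_prod_XsubC -ers.
pose l (i : 'I_p) := rs`_i.
have linj : injective l.
  by move=> i j /eqP; rewrite nth_uniq ?szrs// => /eqP /val_inj.
have ev i : exists2 v : 'rV_p, v *m A = l i *: v & v != 0.
  apply/eigenvalueP; rewrite eigenvalue_root_char ers root_prod_XsubC.
  by rewrite mem_nth ?szrs.
have /choice[v hv] : forall i, exists v : 'rV_p, v *m A = l i *: v /\ v != 0.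
  by move=> i; have [v h1 h2] := ev i; exists v.
pose P := \matrix_i v i.
exists P, l; split=> // [|i]; last by rewrite rowK (hv i).1.
rewrite -row_free_unit -kermx_eq0; apply/eqP/row_matrixP => k.
rewrite row0; set u := row k _.
have uP : u *m P = 0 by apply/sub_kermxP; exact: row_sub.
have sub c i : (c *: v i <= eigenspace A (l i))%MS.
  by rewrite scalemx_sub//; apply/eigenspaceP; exact: (hv i).1.
have /mxdirect_sumsP dir : mxdirect (\sum_i eigenspace A (l i))%MS.
  by apply: mxdirect_sum_eigenspace => i j _ _; exact: linj.
apply/rowP => i; rewrite [RHS]mxE.
have : (u 0 i *: v i <= eigenspace A (l i) :&:
    \sum_(j | true && (j != i)) eigenspace A (l j))%MS.
  rewrite sub_capmx sub//=.
  have : \sum_j u 0 j *: v j = 0.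
    by rewrite -[RHS]uP mulmx_sum_row; apply: eq_bigr => j _; rewrite rowK.
  rewrite (bigD1 i)//= => /eqP; rewrite addr_eq0 => /eqP ->.
  rewrite -scaleN1r scalemx_sub// summx_sub// => j ji.
  by apply: (sumsmx_sup j) => //; exact: sub.
rewrite dir// submx0 scaler_eq0 (negbTE (hv i).2) orbF.
by move/eqP.
Qed.

(** * Complexification and conjugation of matrices *)

Section Complexify.
Variables (R : realType) (p q : nat).
Local Notation C := R[i].
Local Notation cx := (map_mx (real_complex R)).
Local Notation cj := (map_mx (@conjc R)).
Local Notation reM := (map_mx (@complex.Re R)).
Local Notation imM := (map_mx (@complex.Im R)).
Implicit Type M : 'M[C]_(p, q).

Lemma mx_complexE M : M = cx (reM M) + 'i%C *: cx (imM M).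
Proof. by apply/matrixP => i j; rewrite !mxE -complexE. Qed.

Lemma cx_reM M : cx (reM M) = 2^-1 *: (M + cj M).
Proof.
by apply/matrixP => i j; rewrite !mxE ReJ_add mulrC.
Qed.

Lemma cx_imM M : cx (imM M) = (2 * 'i%C)^-1 *: (M - cj M).
Proof.
have i0 : 'i%C != 0 :> C by rewrite eq_complex /= oner_eq0 andbF.
by apply/matrixP => i j; rewrite !mxE subcJ; field.
Qed.

Lemma cjK M : cj (cj M) = M.
Proof. by apply/matrixP => i j; rewrite !mxE conjcK. Qed.

Lemma cj_cx (M : 'M[R]_(p, q)) : cj (cx M) = cx M.
Proof. by apply/matrixP => i j; rewrite !mxE conjc_real. Qed.

Lemma cx_inj : injective (cx : 'M[R]_(p, q) -> 'M[C]_(p, q)).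
Proof. by move=> A B /matrixP h; apply/matrixP=> i j; have := h i j;
  rewrite !mxE => -[]. Qed.

End Complexify.

(** * Vanishing on elements with distinct eigenvalues, and density *)

Section Spectral.
Variables (R : realType) (n : nat).
Local Notation C := R[i].
Local Notation m := (n + n)%N.
Local Notation cx := (map_mx (real_complex R)).
Local Notation cj := (map_mx (@conjc R)).
Local Notation reM := (map_mx (@complex.Re R)).
Local Notation imM := (map_mx (@complex.Im R)).
Local Notation J := (symp_form R n).
Local Notation JC := (symp_form C n).
Local Notation cdot := (@dot C n).
Local Notation sq := (@sq R n).
Local Notation dot := (@dot R n).
Lemma cx_symp_form : cx J = JC.
Proof.
by rewrite /symp_form map_block_mx !map_mx0 map_mxN map_mx1.
Qed.

Lemma cj_symp_form : cj JC = JC.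
Proof. by rewrite -cx_symp_form cj_cx. Qed.

Lemma omega_cx (a b : 'rV[R]_m) : omega (cx a) (cx b) = (omega a b)%:C%C.
Proof. by rewrite /omega -cx_symp_form map_trmx -!map_mxM mxE. Qed.

Lemma omega_complex (v w : 'rV[C]_m) : omega v w =
  ((omega (reM v) (reM w) - omega (imM v) (imM w)) +i*
   (omega (reM v) (imM w) + omega (imM v) (reM w)))%C.
Proof.
rewrite {1}[v]mx_complexE {1}[w]mx_complexE !omegaDE !omega_cx.
by apply/eqP; rewrite eq_complex /=; apply/andP; split; apply/eqP; ring.
Qed.

Lemma reM_cdot v w :
  reM (cdot v w) = dot (reM v) (reM w) - dot (imM v) (imM w).
Proof.
apply/matrixP => i j; rewrite /dot !mxE !big_ord1 !mxE.
case: (v 0 i) (v 0 j) (w 0 i) (w 0 j) => [? ?] [? ?] [? ?] [? ?] /=; ring.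
Qed.

Lemma imM_cdot v w :
  imM (cdot v w) = dot (reM v) (imM w) + dot (imM v) (reM w).
Proof.
apply/matrixP => i j; rewrite /dot !mxE !big_ord1 !mxE.
case: (v 0 i) (v 0 j) (w 0 i) (w 0 j) => [? ?] [? ?] [? ?] [? ?] /=; ring.
Qed.

Variable z : 'M[R]_m -> R.
Hypothesis zq : sym_quasi z.
Hypothesis zdot : forall x y, z (dot x y) = 0.
Hypothesis zsqD : forall x y, z (sq x + sq y) = 0.

(* The case of an eigenvalue that is neither real nor imaginary: [v] and [w] are
   eigenvectors for [l] and [- l], and the imaginary part of their product is
   the difference of two elliptic elements on orthogonal planes. *)
Lemma generic_pair_vanish v w : omega v w = 1 -> omega v (cj v) = 0 ->
  omega w (cj w) = 0 -> omega v (cj w) = 0 ->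
  z (reM (cdot v w)) = 0 /\ z (imM (cdot v w)) = 0.
Proof.
have reJ u : reM (cj u) = reM u :> 'rV_m.
  by apply/matrixP => i j; rewrite !mxE; case: (u i j).
have imJ u : imM (cj u) = - imM u :> 'rV_m.
  by apply/matrixP => i j; rewrite !mxE; case: (u i j).
rewrite !omega_complex !reJ !imJ !omegaDE reM_cdot imM_cdot.
move: (reM v) (imM v) (reM w) (imM w) => a b c d.
move=> [h1 h2] [_ h3] [_ h4] [h5 h6].
have C (x y : 'rV[R]_m) : omega x y = - omega y x by exact: omegaC.
rewrite (C b a) in h3; rewrite (C d c) in h4.
have e1 : omega a b = 0 by lra.
have e2 : omega c d = 0 by lra.
have e3 : omega a d = 0 by lra.
have e4 : omega b c = 0 by lra.
have e5 : omega b d = - omega a c by lra.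
split.
  rewrite -scaleN1r (sym_quasi_orth zq) ?(sym_quasiZ zq) ?zdot ?mulr0 ?addr0//.
  - exact: tr_dot.
  - exact: tr_dot.
  - by rewrite linearZ /= tr_dot.
  by orth_tac; rewrite ?e1 ?e2 ?e3 ?e4 ?(C d c) ?(C c b) ?e2 ?e4; lra.
have -> : dot a d + dot b c = 2^-1 *: (sq (a + d) + sq (b + c)) +
    (- 2^-1) *: (sq (a - d) + sq (b - c)).
  by apply/matrixP => i j; rewrite /sq /dot !mxE !big_ord1 !mxE; field.
have tr2 x y : (sq x + sq y)^T = sq x + sq y by rewrite raddfD /= !tr_sq.
rewrite zq.2 ?zsqD ?mulr0 ?addr0//; apply: orth_comm => //.
by orth_tac; rewrite ?(C d a) ?(C d b) ?(C c b) ?(C c a) ?(C d c) ?(C b a)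
  ?omegaxx;
  rewrite ?e1 ?e2 ?e3 ?e4 ?e5; lra.
Qed.

(** [v + cj v = (1 + t) *: v] recovers [v] from its real part, unless [t = -1], when [v] is purely
    imaginary. *)
Lemma cj_real_multiple (v : 'rV[C]_m) t : cj v = t *: v ->
  exists (s : C) (e : 'rV[R]_m), v = s *: cx e.
Proof.
move=> h; have [t1|t1] := eqVneq (1 + t) 0.
  exists 'i%C, (imM v); rewrite cx_imM h.
  have -> : t = -1 by apply/eqP; rewrite -subr_eq0 opprK addrC t1.
  have i0 : 'i%C != 0 :> C by rewrite eq_complex /= oner_eq0 andbF.
  by apply/rowP => i; rewrite !mxE; field.
exists (2 / (1 + t)), (reM v); rewrite cx_reM h.
by apply/rowP => i; rewrite !mxE; field.
Qed.

(** The case of a real eigenvalue: both eigenlines are real, and only multiples of one hyperbolic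
    element occur. *)
Lemma real_pair_vanish v w t u : cj v = t *: v -> cj w = u *: w ->
  z (reM (cdot v w)) = 0 /\ z (imM (cdot v w)) = 0.
Proof.
move=> /cj_real_multiple[s [e ->]] /cj_real_multiple[s' [f ->]].
have re : reM (cdot (s *: cx e) (s' *: cx f)) = complex.Re (s * s') *: dot e f.
  apply/matrixP => i j; rewrite /dot !mxE !big_ord1 !mxE.
  by case: s s' => [? ?] [? ?] /=; ring.
have im : imM (cdot (s *: cx e) (s' *: cx f)) = complex.Im (s * s') *: dot e f.
  apply/matrixP => i j; rewrite {re} /dot !mxE !big_ord1 !mxE.
  by case: s s' => [? ?] [? ?] /=; ring.
by rewrite re im !(sym_quasiZ zq) ?tr_dot// zdot !mulr0.
Qed.

(** The case of an imaginary eigenvalue [l]: the conjugate of [v] is an eigenvector for [- l], and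
    only multiples of an elliptic element occur. *)
Lemma imaginary_pair_vanish v t :
  z (reM (cdot v (t *: cj v))) = 0 /\ z (imM (cdot v (t *: cj v))) = 0.
Proof.
have re : reM (cdot v (t *: cj v)) =
    (2 * complex.Re t) *: (sq (reM v) + sq (imM v)).
  apply/matrixP => i j; rewrite /sq !mxE !big_ord1 !mxE.
  by case: t (v 0 i) (v 0 j) => [? ?] [? ?] [? ?] /=; ring.
have im : imM (cdot v (t *: cj v)) =
    (2 * complex.Im t) *: (sq (reM v) + sq (imM v)).
  apply/matrixP => i j; rewrite {re} /sq !mxE !big_ord1 !mxE.
  by case: t (v 0 i) (v 0 j) => [? ?] [? ?] [? ?] /=; ring.
by rewrite re im !(sym_quasiZ zq) ?raddfD /= ?tr_sq// zsqD !mulr0.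
Qed.

Lemma sym_quasi_sum (I : Type) (r : seq I) (c : I -> R) (T : I -> 'M[R]_m) :
  (forall i, (T i)^T = T i) ->
  (forall i j, T i *m J *m T j = T j *m J *m T i) ->
  z (\sum_(i <- r) c i *: T i) = \sum_(i <- r) c i * z (T i).
Proof.
move=> sT cT; elim: r => [|i r IH].
  by rewrite !big_nil -(scale0r 0) (sym_quasiZ zq) ?mul0r ?trmx0.
have sS (s : seq I) : (\sum_(i <- s) c i *: T i)^T = \sum_(i <- s) c i *: T i.
  by rewrite linear_sum /=; apply: eq_bigr => k _; rewrite linearZ /= sT.
have cS : T i *m J *m (\sum_(i <- r) c i *: T i) =
    (\sum_(i <- r) c i *: T i) *m J *m T i.
  rewrite mulmx_sumr !mulmx_suml; apply: eq_bigr => k _.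
  by rewrite -scalemxAr cT -!scalemxAl.
rewrite !big_cons; have := zq.2 _ _ (sT i) (sS r) cS (c i) 1.
by rewrite scale1r mul1r IH.
Qed.

(** [omega] pairs each eigenvector with exactly one other, of opposite eigenvalue. This writes [S]
    as a combination of the products [D i] of paired eigenvectors, whose real and imaginary parts
    all commute. *)
Lemma separable_vanish (S : 'M[R]_m) : S^T = S ->
  separable_poly (char_poly (J *m S)) -> z S = 0.
Proof.
move=> hS sep; pose A := JC *m cx S.
have EA : A = cx (J *m S) by rewrite map_mxM cx_symp_form.
have [|P [l [uP linj Pl]]] := @separable_eigenbasis _ _ A.
  by rewrite EA -map_char_poly separable_map.
pose v i := row i P.
have vA i : v i *m A = l i *: v i by exact: Pl.
have skew x y : omega (x *m A) y = - omega x (y *m A).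
  rewrite /omega /A !trmx_mul map_trmx hS tr_symp_form !(mulmxN, mulNmx).
  by rewrite !mulmxA [in RHS]mxE opprK.
have lD i j : omega (v i) (v j) != 0 -> l j = - l i.
  move=> h; have := skew (v i) (v j); rewrite !vA omegaZl omegaZr => /eqP.
  by rewrite -subr_eq0 opprK -mulrDl mulf_eq0 (negbTE h) orbF addr_eq0 =>
    /eqP ->; rewrite opprK.
have Pinj (k : nat) (X Y : 'M[C]_(m, k)) :
  (forall i, v i *m JC *m X = v i *m JC *m Y) -> X = Y.
  move=> h; have : P *m JC *m X = P *m JC *m Y.
    by apply/row_matrixP => i; rewrite !row_mul h.
  have uPJ : P *m JC \in unitmx by rewrite unitmx_mul uP symp_form_unit.
  by move=> /(congr1 (mulmx (invmx (P *m JC)))); rewrite !mulKmx.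
have /choice[s hs] : forall i, exists j, omega (v i) (v j) != 0.
  move=> i; apply: contrapT => nex.
  suff : v i = 0.
    move=> v0; have := row_mul i P (invmx P).
    rewrite mulmxV// -/(v i) v0 mul0mx => /rowP /(_ i).
    by rewrite !mxE eqxx => /eqP; rewrite oner_eq0.
  apply: trmx_inj; rewrite trmx0; apply: (Pinj 1%N) => j; rewrite mulmx0 omegaE.
  suff -> : omega (v j) (v i) = 0 by rewrite raddf0.
  apply/eqP; apply: contrapT => /negP h; apply: nex; exists j.
  by rewrite omegaC oppr_eq0.
have ls i : l (s i) = - l i by apply: lD.
have sE i j : omega (v i) (v j) != 0 -> j = s i.
  by move=> /lD h; apply: linj; rewrite h ls.
have ss i : s (s i) = i by apply/esym/sE; rewrite omegaC oppr_eq0.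
pose w i := (omega (v i) (v (s i)))^-1 *: v (s i).
have ovw i : omega (v i) (w i) = 1 by rewrite omegaZr mulVf.
have wA i : w i *m A = - l i *: w i.
  by rewrite -scalemxAl vA ls !scalerA mulrC.
pose D i := cdot (v i) (w i).
have vD k i : v k *m JC *m D i = omega (v k) (v i) *:
  w i + omega (v k) (w i) *: v i.
  by rewrite mulmxDr !mul_outer.
have evD k i : exists c, v k *m JC *m D i = c *: v k.
  rewrite vD; have [->|ki] := eqVneq i k.
    by rewrite omegaxx scale0r add0r; exists (omega (v k) (w k)).
  have -> : omega (v k) (w i) = 0.
    rewrite omegaZr; have [->|h] := eqVneq (omega (v k) (v (s i))) 0.
      by rewrite mulr0.
    by move/eqP: ki; case; rewrite -[LHS]ss (sE _ _ h) ss.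
  rewrite scale0r addr0.
  have [->|h] := eqVneq (omega (v k) (v i)) 0; first by exists 0;
    rewrite !scale0r.
  by rewrite /w (sE _ _ h) ss scalerA; eexists.
have eigen (x : 'rV[C]_m) (mu : C) : x != 0 -> x *m A = mu *: x ->
    exists j t, mu = l j /\ x = t *: v j.
  move=> x0 hx; pose u := x *m invmx P.
  have xu : x = \sum_j u 0 j *: v j.
    by rewrite -[LHS](mulmxKV uP) mulmx_sum_row.
  have hu j : u 0 j != 0 -> mu = l j.
    move=> uj; have : \row_j (u 0 j * (l j - mu)) *m P = 0.
      rewrite mulmx_sum_row; under eq_bigr do rewrite mxE mulrBr scalerBl.
      rewrite sumrB; apply/eqP; rewrite subr_eq0; apply/eqP.
      transitivity (x *m A).
        rewrite {1}xu mulmx_suml; apply: eq_bigr => k _.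
        by rewrite -scalemxAl vA scalerA.
      rewrite hx {1}xu scaler_sumr; apply: eq_bigr => k _.
      by rewrite scalerA mulrC.
    move=> /(congr1 (mulmxr (invmx P))) /=; rewrite mulmxK// mul0mx.
    move=> /rowP /(_ j); rewrite [LHS]mxE [RHS]mxE => /eqP;
      rewrite mulf_eq0 (negbTE uj)/=.
    by rewrite subr_eq0 => /eqP.
  have /existsP[j uj] : [exists j, u 0 j != 0].
    apply: contraT; rewrite negb_exists => /forallP h.
    move: x0; rewrite xu big1 ?eqxx// => j _.
    by have := h j; rewrite negbK => /eqP ->; rewrite scale0r.
  exists j, (u 0 j); split; first exact: hu.
  rewrite {1}xu (bigD1 j)//= big1 ?addr0// => k kj.
  have [->|uk] := eqVneq (u 0 k) 0; first by rewrite scale0r.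
  by move/eqP: kj; case; apply: linj; rewrite -(hu _ uj) -(hu _ uk).
have v0 i : v i != 0.
  by apply: contraTneq (hs i) => ->; rewrite omega0l eqxx.
have cjA (x : 'rV[C]_m) (mu : C) : x *m A = mu *: x ->
  cj x *m A = (mu^*)%C *: cj x.
  by move=> h; rewrite EA -[cx _]cj_cx -map_mxM -EA h map_mxZ.
have cj0 (x : 'rV[C]_m) : x != 0 -> cj x != 0.
  by apply: contra => /eqP h; rewrite -[x]cjK h map_mx0.
(* Conjugation permutes the eigenlines, so the conjugates of the [D i] act diagonally on the same
   basis; hence so do the real and imaginary parts. *)
have evcjD k i : exists c, v k *m JC *m cj (D i) = c *: v k.
  have [j [t [_ hj]]] := eigen _ _ (cj0 _ (v0 k)) (cjA _ _ (vA k)).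
  have [c hc] := evD j i; exists (c^*)%C.
  have e : cj (v k *m JC *m cj (D i)) = c *: cj (v k).
    by rewrite !map_mxM cjK cj_symp_form hj -!scalemxAl hc !scalerA mulrC.
  by rewrite -[LHS]cjK e map_mxZ cjK.
pose ev (M : 'M[C]_m) := forall k, exists c, v k *m JC *m M = c *: v k.
have evZD c M N : ev M -> ev N -> ev (c *: (M + N)).
  move=> hM hN k; have [x hx] := hM k; have [y hy] := hN k.
  exists (c * (x + y)); rewrite -scalemxAr mulmxDr hx hy.
  by rewrite -scalerDl scalerA.
have evN M : ev M -> ev (- M).
  by move=> hM k; have [x hx] := hM k; exists (- x); rewrite mulmxN hx scaleNr.
have comm (M N : 'M[R]_m) : ev (cx M) -> ev (cx N) -> M *m J *m N = N *m J *m M.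
  move=> hM hN; apply: cx_inj; rewrite !map_mxM cx_symp_form.
  apply: Pinj => k; have [x hx] := hM k; have [y hy] := hN k.
  rewrite !mulmxA hx hy -!scalemxAl hx hy !scalerA mulrC.
  by [].
have evre i : ev (cx (reM (D i))).
  by rewrite cx_reM; apply: evZD => k; [exact: evD|exact: evcjD].
have evim i : ev (cx (imM (D i))).
  rewrite cx_imM; apply: evZD => [k|]; first exact: evD.
  by apply: evN => k; exact: evcjD.
(* Since [D (s i) = - D i] and [l (s i) = - l i], each pair occurs twice in the sum; hence the
   factor one half. *)
have SD : cx S = \sum_i (l i / 2) *: D i.
  apply: Pinj => k; rewrite -mulmxA -/A vA mulmx_sumr.
  rewrite (bigD1 k)//= (bigD1 (s k))//=; last first.
    by apply: contraTneq (hs k) => ->; rewrite omegaxx eqxx.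
  rewrite big1 ?addr0; last first.
    move=> i /andP[ik isk]; rewrite -scalemxAr vD.
    have -> : omega (v k) (v i) = 0.
      by apply/eqP; apply: contraNT isk => /sE ->.
    have -> : omega (v k) (w i) = 0.
      rewrite omegaZr; apply/eqP; rewrite mulf_eq0; apply/orP; right.
      by apply: contraNT ik => /sE h; rewrite -(ss k) -h ss.
    by rewrite !scale0r addr0 scaler0.
  rewrite -!scalemxAr !vD omegaxx scale0r add0r ovw scale1r.
  have -> : omega (v k) (w (s k)) = 0 by rewrite omegaZr ss omegaxx mulr0.
  rewrite scale0r addr0 /w ss ls (omegaC (v (s k))) !scalerA -scalerDl.
  by congr (_ *: _); field; rewrite hs.
have w0 i : w i != 0.
  by apply: contra_eqN (ovw i) => /eqP ->; rewrite omega0r eq_sym oner_eq0.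
have cN (x : C) : ((- x)^*)%C = - (x^*)%C by case: x.
(* Three cases: the conjugate of [l i] is [l i] (real), [- l i] (imaginary), or another
   eigenvalue. *)
have key i : z (reM (D i)) = 0 /\ z (imM (D i)) = 0.
  have [jv [tv [hlv hv]]] := eigen _ _ (cj0 _ (v0 i)) (cjA _ _ (vA i)).
  have [jw [tw [hlw hw]]] := eigen _ _ (cj0 _ (w0 i)) (cjA _ _ (wA i)).
  have tv0 : tv != 0.
    by apply: contraNneq (cj0 _ (v0 i)) => tv0; rewrite hv tv0 scale0r.
  have [ei|ei] := eqVneq jv i.
    have ew : jw = s i.
      by apply: linj; rewrite ls -hlw cN hlv ei.
    apply: (@real_pair_vanish _ _ tv (tw * omega (v i) (v (s i)))).
      by rewrite hv ei.
    by rewrite hw ew /w scalerA -mulrA mulfV// mulr1.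
  have [es|es] := eqVneq jv (s i).
    have -> : D i = cdot (v i) (((omega (v i) (v (s i)))^-1 / tv) *: cj (v i)).
      by rewrite hv es scalerA divfK.
    exact: imaginary_pair_vanish.
  have ow j k : j != s k -> omega (v k) (v j) = 0.
    by move=> h; apply/eqP; apply: contraNT h => /sE ->.
  have hjw : jw = s jv.
    by apply: linj; rewrite ls -hlv -hlw cN.
  apply: generic_pair_vanish => //.
  - by rewrite hv omegaZr ow ?mulr0.
  - rewrite hw hjw omegaZr /w omegaZl (ow (s jv) (s i)) ?mulr0//.
    rewrite ss; by apply: contraNneq es => h; rewrite -(ss jv) h.
  - rewrite hw hjw omegaZr ow ?mulr0//.
    by apply: contraNneq ei => h; rewrite -(ss jv) h ss.
pose T (x : 'I_m + 'I_m) := match x with inl i => reM (D i) | inr i =>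
  imM (D i) end.
pose c (x : 'I_m + 'I_m) := match x with
  inl i => complex.Re (l i / 2 : C) | inr i => - complex.Im (l i / 2 : C) end.
have -> : S = \sum_x c x *: T x.
  have -> : S = reM (cx S) by apply/matrixP => a b; rewrite !mxE.
  rewrite SD big_sumType /= -big_split /=; apply/matrixP => a b.
  rewrite mxE !summxE (big_morph (@complex.Re R) (id1 := 0) (op1 := +%R))//.
    apply: eq_bigr => i _; move: (D i) (l i / 2) => X y; rewrite !mxE.
    by case: (X a b) y => [? ?] [? ?] /=; rewrite mulNr.
  by move=> [? ?] [? ?].
rewrite sym_quasi_sum.
- by apply: big1 => -[i|i] _ /=; have [e1 e2] := key i; rewrite ?e1 ?e2 mulr0.
- have trD i : (D i)^T = D i by exact: tr_dot.
  by move=> [i|i] /=; rewrite map_trmx trD.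
- by move=> [i|i] [j|j] /=; apply: comm.
Qed.

(** [J S1] is made diagonal, with the distinct entries [1, ..., n, -1, ..., -n]. *)
Lemma separable_symplectic : exists2 S1 : 'M[R]_m, S1^T = S1 &
  separable_poly (char_poly (J *m S1)).
Proof.
pose d : 'rV[R]_n := \row_i (i.+1)%:R.
exists (block_mx 0 (diag_mx d) (diag_mx d) 0).
  by rewrite tr_block_mx !trmx0 !tr_diag_mx.
pose e := row_mx d (- d).
have -> : J *m block_mx 0 (diag_mx d) (diag_mx d) 0 = diag_mx e.
  rewrite /symp_form mulmx_block !mul0mx !mulmx0 !mul1mx mulNmx mul1mx.
  by rewrite !add0r !addr0 diag_mx_row linearN.
rewrite char_poly_trig ?diag_mx_is_trig//.
have -> : \prod_(i < m) ('X - ((diag_mx e) i i)%:P) =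
    \prod_(x <- [seq e 0 i | i <- enum 'I_m]) ('X - x%:P).
  by rewrite big_map big_enum; apply: eq_bigr => i _; rewrite mxE eqxx mulr1n.
rewrite separable_prod_XsubC map_inj_uniq ?enum_uniq// => i j.
have pos k : 0 < d 0 k by rewrite mxE ltr0n.
have dinj : injective (d 0) by move=> k l /eqP; rewrite !mxE eqr_nat eqSS =>
  /eqP /val_inj.
have nd k : (- d) 0 k = - d 0 k by rewrite mxE.
rewrite /e !mxE; case: split_ordP => k ->; case: split_ordP => l ->.
- by move/dinj ->.
- rewrite nd => h; exfalso; have := pos k; have := pos l; lra.
- rewrite nd => h; exfalso; have := pos k; have := pos l; lra.
- by rewrite !nd => /oppr_inj /dinj ->.
Qed.

(* The exceptional [t] are roots of the discriminant, a polynomial in [t]. *)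
Lemma generic_separable (p : nat) (A B : 'M[R]_p) :
  (0 < p)%N -> separable_poly (char_poly (A + B)) ->
  exists2 r : {poly R}, r != 0 &
    forall t, ~~ root r t -> separable_poly (char_poly (A + t *: B)).
Proof.
move=> p0 sep; pose M := map_mx polyC A + 'X *: map_mx polyC B.
pose X := char_poly M.
have ME t : map_mx (horner_eval t) M = A + t *: B.
  by apply/matrixP => i j; rewrite !mxE /horner_eval !hornerE.
have XE t : map_poly (horner_eval t) X = char_poly (A + t *: B).
  by rewrite map_char_poly ME.
have sX : size X = p.+1 by exact: size_char_poly.
(* The leading coefficients 1 of [X] and [p] of its derivative are nonzero constants, so the
   resultant commutes with evaluation at [t]. *)
have cX : X^`()`_p.-1 = p%:R.
  have lc : X`_p = 1.
    by have := monicP (char_poly_monic M); rewrite lead_coefE -/X sX.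
  by rewrite coef_deriv prednK// lc.
have s' : size X^`() = p.
  apply/eqP; rewrite eqn_leq; apply/andP; split.
    by rewrite -ltnS -sX lt_size_deriv// monic_neq0// char_poly_monic.
  rewrite -(prednK p0) ltnNge; apply/negP => /leq_sizeP /(_ _ (leqnn _)).
  by rewrite cX => /eqP; rewrite -polyC_natr polyC_eq0 pnatr_eq0 eqn0Ngt p0.
have res t : (resultant X X^`()).[t] =
    resultant (char_poly (A + t *: B)) (char_poly (A + t *: B))^`().
  rewrite -XE -[_.[t]]/(horner_eval t _) map_resultant ?deriv_map//.
    by rewrite (monicP (char_poly_monic M)) /= /horner_eval hornerC oner_neq0.
  rewrite lead_coefE s' cX -polyC_natr /= /horner_eval hornerC pnatr_eq0.
  by rewrite -lt0n.
have sepE t : separable_poly (char_poly (A + t *: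
  B)) = ~~ root (resultant X X^`()) t.
  rewrite rootE res resultant_eq0 unlock /coprimep -leqNgt eqn_leq lt0n.
  rewrite size_poly_eq0 gcdp_eq0 [char_poly _ == 0]negbTE ?andbT//.
  by rewrite monic_neq0 ?char_poly_monic.
exists (resultant X X^`()) => [|t]; last by rewrite sepE.
have := sepE 1; rewrite scale1r sep => /esym.
by apply: contraTneq => ->; rewrite root0.
Qed.

(** On the line from [S] to [S1] all but finitely many elements have distinct eigenvalues, and [z]
    is continuous at [S]. *)
Lemma sym_quasi_vanish (S : 'M[R]_m) : S^T = S -> z S = 0.
Proof.
move=> hS; have [n0|n0] := posnP m.
  suff -> : S = 0 *: S by rewrite (sym_quasiZ zq)// mul0r.
  by apply/matrixP => i; have := ltn_ord i; rewrite {2}n0.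
have [S1 hS1 sep] := separable_symplectic.
have [|r r0 hr] := @generic_separable _ (J *m S) (J *m (S1 - S)) n0.
  by rewrite -mulmxDr addrC subrK.
pose p t := z (t *: (S1 - S) + S).
have cp : continuous p by exact: sym_quasi_line.
have zp t : ~~ root r t -> p t = 0.
  move=> /hr; rewrite scalemxAr -mulmxDr addrC; apply: separable_vanish.
  by rewrite raddfD /= linearZ /= raddfB /= hS hS1.
have -> : z S = p 0 by rewrite /p scale0r add0r.
apply/eqP; apply: contrapT => /negP p0.
have nb : nbhs (p 0) [set~ (0 : R)].
  apply: open_nbhs_nbhs; split; last exact/eqP.
  exact/closed_openC/closed_eq.
have := cp 0 _ nb.
move=> /nbhs_ballP[e /= e0 he].
(* If [p] had no zero in the ball of radius [e], these distinct points of the ball would all be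
   roots of [r]; taking [size r] of them is one too many. *)
pose t k : R := e / k.+2%:R.
suff : (size [seq t k | k <- iota 0 (size r)] < size r)%N.
  by rewrite size_map size_iota ltnn.
apply: max_poly_roots => //.
  apply/allP => _ /mapP[k _ ->]; apply: contrapT => /negP /zp h.
  have /he : ball (0 : R) e (t k); last exact.
  rewrite -ball_normE /= sub0r normrN ger0_norm ?divr_ge0 ?ltW//.
  by rewrite ltr_pdivrMr ?ltr0n// ltr_pMr// ltr1n.
rewrite map_inj_uniq ?iota_uniq// => k l /(mulfI (lt0r_neq0 e0)) /invr_inj.
by move=> /eqP; rewrite eqr_nat !eqSS => /eqP.
Qed.

End Spectral.

Local Open Scope sesquilinear_scope.

(** * Invariant nonnegative subspaces *)

Section Hermitian.
Variables (C : numClosedFieldType) (N : nat) (H : 'M[C]_N).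
Hypothesis hermH : H^t* = H.
Implicit Types (x y : 'rV[C]_N) (f g : 'M[C]_N).

Definition hform x y := (x *m H *m y^t*) 0 0.

Lemma hformDl x y w : hform (x + y) w = hform x w + hform y w.
Proof. by rewrite /hform !mulmxDl mxE. Qed.
Lemma hformZl c x w : hform (c *: x) w = c * hform x w.
Proof. by rewrite /hform -!scalemxAl mxE. Qed.
Lemma hformC x y : hform x y = (hform y x)^*.
Proof.
rewrite /hform; have -> : x *m H *m y^t* = (y *m H *m x^t*)^t*.
  by rewrite !trmx_mul !map_mxM -mulmxA trmxCK hermH.
by rewrite !mxE.
Qed.
Lemma hformDr x y w : hform w (x + y) = hform w x + hform w y.
Proof. by rewrite [LHS]hformC hformDl rmorphD [hform w x]hformC [hform w
  y]hformC. Qed.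
Lemma hformZr c x w : hform w (c *: x) = c^* * hform w x.
Proof. by rewrite [LHS]hformC hformZl rmorphM [in RHS]hformC. Qed.
Lemma hform0l w : hform 0 w = 0.
Proof. by rewrite /hform !mul0mx mxE. Qed.
Lemma hform_real x : hform x x \is Num.real.
Proof. by apply/CrealP; rewrite [RHS]hformC. Qed.
Lemma hform_perp x y : (y <= kermx (H *m x^t*))%MS = (hform y x == 0).
Proof.
apply/sub_kermxP/eqP => [h|h]; first by rewrite /hform -mulmxA h mxE.
by rewrite mulmxA [LHS]mx11_scalar -/(hform y x) h raddf0.
Qed.

Definition skewh f := f *m H = - (H *m f^t*).

Lemma skewhE f x y : skewh f -> hform (x *m f) y = - hform x (y *m f).
Proof.
move=> hf; rewrite /hform trmx_mul map_mxM -(mulmxA x) hf.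
by rewrite mulmxN mulNmx mxE !mulmxA.
Qed.

Definition nonneg p (W : 'M[C]_(p, N)) := forall x, (x <= W)%MS ->
  0 <= hform x x.

Lemma nonneg_isotropic p (W : 'M[C]_(p, N)) x y : nonneg W ->
  (x <= W)%MS -> hform x x = 0 -> (y <= W)%MS -> hform x y = 0.
Proof.
move=> hW xW x0 yW; apply/eqP; apply: contraT => c0.
set c := hform x y in c0.
have n0 : 0 < `|c| ^+ 2 by rewrite exprn_gt0// normr_gt0.
have hy := hW y yW.
pose s := (hform y y + 1) / `|c| ^+ 2.
have s0 : 0 <= s by rewrite divr_ge0 ?addr_ge0// ltW.
have := hW (y + (- (s * c^*)) *: x).
rewrite addmx_sub ?scalemx_sub// => /(_ isT).
rewrite !hformDl !hformDr !hformZl !hformZr x0 (hformC y x) -/c.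
rewrite !mulr0 addr0 rmorphN rmorphM /= conjCK (CrealP (ger0_real s0)) !mulNr.
have -> : - (s * c * c^*) = - (hform y y + 1).
  by rewrite -mulrA -normCK /s divfK// gt_eqF.
have -> : s * c^* * c = hform y y + 1.
  by rewrite -mulrA (mulrC c^*) -normCK /s divfK// gt_eqF.
have -> : hform y y - (hform y y + 1) - (hform y y + 1) = - (hform y y + 2).
  by ring.
by rewrite oppr_ge0 => /(lt_le_trans (ltr_wpDl hy (ltr0n _ 2))); rewrite ltxx.
Qed.

Lemma stable_sub f p (W : 'M[C]_(p, N)) x :
  (W *m f <= W)%MS -> (x <= W)%MS -> (x *m f <= W)%MS.
Proof. by move=> hW xW; exact: submx_trans (submxMr f xW) hW. Qed.

Lemma stable_subP f p (W : 'M[C]_(p, N)) :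
  (forall x, (x <= W)%MS -> (x *m f <= W)%MS) -> (W *m f <= W)%MS.
Proof. by move=> h; apply/row_subP => i; rewrite row_mul h// row_sub. Qed.

(** The factors [f - c] of the characteristic polynomial are applied one by one to a vector of [Y]
    outside [Z]. By Cayley-Hamilton the result ends in [Z]; the last vector outside [Z] is an
    eigenvector modulo [Z]. *)
Lemma eigen_mod f (Y Z : 'M[C]_N) : (Y *m f <= Y)%MS -> (Z *m f <= Z)%MS ->
  ~~ (Y <= Z)%MS ->
  exists l x, [/\ (x <= Y)%MS, ~~ (x <= Z)%MS & (x *m (f - l%:M) <= Z)%MS].
Proof.
move=> sY sZ /row_subPn[i hi].
have [rs ers] := closed_field_poly_normal (char_poly f).
move: ers; rewrite (monicP (char_poly_monic f)) scale1r => ers.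
have key (s : seq C) x : (x <= Y)%MS -> ~~ (x <= Z)%MS ->
    (foldl (fun v c => v *m (f - c%:M)) x s <= Z)%MS ->
    exists l x, [/\ (x <= Y)%MS, ~~ (x <= Z)%MS & (x *m (f - l%:M) <= Z)%MS].
  elim: s x => [|c s IH] x xY xZ /=; first by rewrite (negbTE xZ).
  have [h _|h] := boolP (x *m (f - c%:M) <= Z)%MS; first by exists c, x.
  apply: IH => //; rewrite mulmxBr addmx_sub ?stable_sub//.
  by rewrite mul_mx_scalar -scaleNr scalemx_sub.
apply: (key rs (row i Y)) => //; first exact: row_sub.
suff -> : foldl (fun v c => v *m (f - c%:M)) (row i Y) rs = 0 by exact: sub0mx.
clear -ers; move: f (row i Y) ers; case: N => [|k] f v ers.
  by rewrite [LHS]thinmx0.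
have e (s : seq C) u : foldl (fun v c => v *m (f - c%:M)) u s =
    u *m horner_mx f (\prod_(c <- s) ('X - c%:P)).
  elim: s u => [|c s IH] u /=; first by rewrite big_nil rmorph1 mulmx1.
  rewrite IH big_cons rmorphM /= -mulmxA; congr (_ *m (_ *m _)).
  by rewrite rmorphB /= horner_mx_X horner_mx_C.
by rewrite e -ers (Cayley_Hamilton f) mulmx0.
Qed.

(** The vectors of [U] that [f - l] sends into [Z] form a space [Y] stable under [g], where an
    eigenvector of [g] modulo [Z] is taken. *)
Lemma common_eigen_mod f g (U Z : 'M[C]_N) : f *m g = g *m f ->
  (U *m f <= U)%MS -> (Z *m f <= Z)%MS -> (U *m g <= U)%MS ->
    (Z *m g <= Z)%MS ->
  ~~ (U <= Z)%MS ->
  exists l k x, [/\ (x <= U)%MS, ~~ (x <= Z)%MS,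
    (x *m (f - l%:M) <= Z)%MS & (x *m (g - k%:M) <= Z)%MS].
Proof.
move=> cfg fU fZ gU gZ UZ; have [l [x [xU xZ xl]]] := eigen_mod fU fZ UZ.
pose Y := (U :&: kermx ((f - l%:M) *m cokermx Z))%MS.
have YP y : (y <= Y)%MS = (y <= U)%MS && (y *m (f - l%:M) <= Z)%MS.
  rewrite sub_capmx; congr (_ && _).
  rewrite [RHS]submxE -mulmxA; exact/sub_kermxP/eqP.
have YZ : ~~ (Y <= Z)%MS.
  by apply: contra xZ => h; apply: submx_trans h; rewrite YP xU.
have gY : (Y *m g <= Y)%MS.
  apply: stable_subP => y; rewrite !YP => /andP[yU yl].
  rewrite stable_sub//= -mulmxA mulmxBr -cfg scalar_mxC -mulmxBl mulmxA.
  exact: stable_sub.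
have [k [y [yY yZ yk]]] := eigen_mod gY gZ YZ.
by move: yY; rewrite YP => /andP[yU yl]; exists l, k, y.
Qed.

Lemma cap_kermx_rank p (P : 'M[C]_(p, N)) (v : 'cV[C]_N) :
  (\rank P <= (\rank (P :&: kermx v)%MS).+1)%N.
Proof.
have <- := mxrank_mul_ker P v.
exact: (@leq_add _ _ 1 _ (rank_leq_col _) (leqnn _)).
Qed.

Lemma addsmx_row_rank p (W : 'M[C]_(p, N)) x : ~~ (x <= W)%MS ->
  \rank (W + x)%MS = (\rank W).+1.
Proof.
move=> h; apply/eqP; rewrite eqn_leq; apply/andP; split.
  rewrite (leq_trans (mxrank_adds_leqif _ _))// addnC.
  exact: (@leq_add _ _ 1 _ (rank_leq_row _) (leqnn _)).
apply: rank_ltmx; rewrite ltmxE addsmxSl /=; apply: contra h => h.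
exact: submx_trans (addsmxSr _ _) h.
Qed.

Lemma sub_adds_rowP p (W : 'M[C]_(p, N)) x y : (y <= W + x)%MS ->
  exists w c, (w <= W)%MS /\ y = w + c *: x.
Proof.
move=> /sub_addsmxP[[u v] /= ->]; exists (u *m W), (v 0 0).
by rewrite submxMl; split=> //; rewrite {1}[v]mx11_scalar mul_scalar_mx.
Qed.

Section Invariant.
Variables f g : 'M[C]_N.
Hypotheses (cfg : f *m g = g *m f) (hf : skewh f) (hg : skewh g).

(** Modulo [Z], which is orthogonal to [U], the vector [x] is an eigenvector; so [k], being skew,
    preserves its orthogonal in [U]. *)
Lemma perp_stable (k : 'M[C]_N) (U Z : 'M[C]_N) x l : skewh k ->
  (forall u v, (u <= Z)%MS -> (v <= U)%MS -> hform u v = 0) ->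
  (U *m k <= U)%MS -> (x *m (k - l%:M) <= Z)%MS ->
  ((U :&: kermx (H *m x^t*)) *m k <= U :&: kermx (H *m x^t*))%MS.
Proof.
move=> hk ZU kU xl; apply: stable_subP => y; rewrite !sub_capmx.
rewrite !hform_perp => /andP[yU /eqP hy];
  rewrite stable_sub//= skewhE// oppr_eq0.
have -> : x *m k = x *m (k - l%:M) + l *: x.
  by rewrite mulmxBr mul_mx_scalar subrK.
by rewrite hformDr hformZr hy mulr0 addr0 hformC ZU ?conjC0.
Qed.

(* Induction on the dimension of [U / Z], where [Z] lies in the radical of [U]: a
   common eigenvector [x] modulo [Z] is split off [U] when it is not isotropic,
   and otherwise enlarges [Z] or allows [U] to be replaced by the orthogonal of
   [x] in [U]. *)
Lemma nonneg_invariant_ext (k : nat) (U Z P : 'M[C]_N) :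
  (\rank U <= \rank Z + k)%N -> (Z <= U)%MS ->
  (forall u v, (u <= Z)%MS -> (v <= U)%MS -> hform u v = 0) ->
  (U *m f <= U)%MS -> (U *m g <= U)%MS -> (Z *m f <= Z)%MS ->
    (Z *m g <= Z)%MS ->
  (P <= U)%MS -> nonneg P ->
  exists W : 'M[C]_N, [/\ (Z <= W)%MS, (W <= U)%MS,
    (W *m f <= W)%MS /\ (W *m g <= W)%MS, nonneg W & (\rank P <= \rank W)%N].
Proof.
elim: k U Z P => [|k IH] U Z P rUZ ZU perp fU gU fZ gZ PU P0.
  have UZ : (U <= Z)%MS.
    by rewrite -(mxrank_leqif_sup ZU) eqn_leq mxrankS//= -[X in (_ <=
      X)%N]addn0.
  exists U; split=> // [x xU|]; last exact: mxrankS.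
  by rewrite perp// (submx_trans xU).
have [UZ|UZ] := boolP (U <= Z)%MS.
  exists U; split=> // [x xU|]; last exact: mxrankS.
  by rewrite perp// (submx_trans xU).
have [l [l' [x [xU xZ xf xg]]]] := common_eigen_mod cfg fU fZ gU gZ UZ.
pose U' := (U :&: kermx (H *m x^t*))%MS.
have U'U : (U' <= U)%MS by exact: capmxSl.
have U'P y : (y <= U')%MS = (y <= U)%MS && (hform y x == 0).
  by rewrite sub_capmx hform_perp.
have fU' : (U' *m f <= U')%MS by exact: perp_stable hf perp fU xf.
have gU' : (U' *m g <= U')%MS by exact: perp_stable hg perp gU xg.
have ZU' : (Z <= U')%MS.
  apply/row_subP => i; rewrite U'P perp ?eqxx ?row_sub// andbT.
  exact: submx_trans (row_sub _ _) ZU.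
have perp' u v : (u <= Z)%MS -> (v <= U')%MS -> hform u v = 0.
  by move=> uZ vU; apply: perp => //; exact: submx_trans vU U'U.
have rU' w : (w <= U)%MS -> hform w x != 0 -> (\rank U' <= \rank Z + k)%N.
  move=> wU wx; rewrite -ltnS -addnS; apply: leq_trans rUZ.
  apply: rank_ltmx; rewrite ltmxE U'U /=; apply: contra wx => h.
  by have := submx_trans wU h; rewrite U'P => /andP[].
have xE (h : 'M[C]_N) c : x *m h = x *m (h - c%:M) + c *: x.
  by rewrite mulmxBr mul_mx_scalar subrK.
have stable_add (h : 'M[C]_N) c (W : 'M[C]_N) : (Z <= W)%MS ->
  (W *m h <= W)%MS ->
    (x *m (h - c%:M) <= Z)%MS -> ((W + x)%MS *m h <= W + x)%MS.
  move=> ZW hW hx; rewrite addsmxMr addsmx_sub; apply/andP; split.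
    exact: submx_trans hW (addsmxSl _ _).
  rewrite (xE h c) addmx_sub//; last by rewrite scalemx_sub ?addsmxSr.
  exact: submx_trans hx (submx_trans ZW (addsmxSl _ _)).
have [x0|x0] := eqVneq (hform x x) 0.
  have [xP|[w [wU wx]]] : (forall w, (w <= U)%MS -> hform w x = 0) \/
      exists w, (w <= U)%MS /\ hform w x != 0.
    have [h|/row_subPn[i hi]] := boolP (U <= U')%MS.
      by left=> w wU; have := submx_trans wU h; rewrite U'P wU => /eqP.
    right; exists (row i U); rewrite row_sub; split=> //.
    by move: hi; rewrite U'P row_sub.
  - have [|||||||||W [ZW WU sW W0 rW]] := IH U (Z + x)%MS P.
    + by rewrite addsmx_row_rank// addSnnS.
    + by rewrite addsmx_sub ZU.
    + move=> u v /sub_adds_rowP[w [c [wZ ->]]] vU.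
      by rewrite hformDl hformZl perp// hformC xP// conjC0 mulr0 addr0.
    + by [].
    + by [].
    + exact: stable_add xf.
    + exact: stable_add xg.
    + by [].
    + by [].
    by exists W; split=> //; exact: submx_trans (addsmxSl _ _) ZW.
  (* The intersection loses at most one dimension, which [x] restores when it is outside [P]; when
     [x] lies in [P], being isotropic it is orthogonal to all of [P] and nothing is lost. *)
  - pose P1 := ((P :&: kermx (H *m x^t*)) + x)%MS.
    have PP y : (y <= P :&: kermx (H *m x^t*))%MS = (y <= P)%MS && (hform y x == 0).
      by rewrite sub_capmx hform_perp.
    have xU' : (x <= U')%MS by rewrite U'P xU x0 eqxx.
    have [||W [ZW WU sW W0 rW]] :=
      IH U' Z P1 (rU' _ wU wx) ZU' perp' fU' gU' fZ gZ.
    + by rewrite addsmx_sub xU' andbT capmxS.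
    + move=> y /sub_adds_rowP[p [c []]]; rewrite PP => /andP[pP /eqP px] ->.
      rewrite hformDl !hformDr !hformZl !hformZr x0 px (hformC x p) px conjC0.
      by rewrite !mulr0 !addr0; exact: P0.
    exists W; split=> //; first exact: submx_trans U'U.
    apply: leq_trans rW; have [xP|xP] := boolP (x <= P)%MS.
      apply: mxrankS; apply/row_subP => i; apply: submx_trans (addsmxSl _ _).
      by rewrite PP row_sub hformC (nonneg_isotropic P0 xP x0) ?row_sub//
        conjC0 eqxx.
    rewrite addsmx_row_rank ?cap_kermx_rank// PP negb_and xP.
    by [].
have [W0|W0] : hform x x < 0 \/ 0 < hform x x.
  have := hform_real x; rewrite realE => /orP[|] h; [right|left].
    by rewrite lt_neqAle eq_sym x0.
  by rewrite lt_neqAle x0.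
(* Orthogonal projection along the negative vector [x]. It does not decrease the form, and it is
   injective on [P] because its kernel is the negative line of [x]. *)
- pose pr : 'M[C]_N := 1%:M - (hform x x)^-1 *: (H *m x^t* *m x).
  have prE y : y *m pr = y - (hform y x / hform x x) *: x.
    rewrite mulmxBr mulmx1 -scalemxAr !mulmxA (mx11_scalar (y *m H *m x^t*)).
    by rewrite mul_scalar_mx scalerA mulrC.
  have prx y : hform (y *m pr) x = 0.
    by rewrite prE -scaleNr hformDl hformZl mulNr divfK// subrr.
  have prh y : hform y y <= hform (y *m pr) (y *m pr).
    have -> : hform (y *m pr) (y *m pr) = hform (y *m pr) y.
      by rewrite [X in hform _ X]prE -scaleNr hformDr hformZr prx mulr0 addr0.
    rewrite prE -scaleNr hformDl hformZl (hformC x y) mulNr mulrAC -normCK.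
    rewrite lerDl oppr_ge0 -(opprK (hform x x)) invrN mulrN oppr_le0.
    by rewrite mulr_ge0 ?exprn_ge0// invr_ge0 oppr_ge0 ltW.
  have [||W [ZW WU sW W'0 rW]] :=
    IH U' Z (P *m pr) (rU' _ xU x0) ZU' perp' fU' gU' fZ gZ.
  + apply/row_subP => i; rewrite row_mul U'P prx eqxx andbT prE.
    have yU : (row i P <= U)%MS by exact: submx_trans (row_sub _ _) PU.
    by rewrite addmx_sub// -scaleNr scalemx_sub.
  + move=> y /submxP[D ->]; rewrite mulmxA.
    by apply: le_trans (prh _); apply: P0; exact: submxMl.
  exists W; split=> //; first exact: submx_trans U'U.
  apply: leq_trans rW; rewrite -(mxrank_mul_ker P pr) -[X in (_ <= X)%N]addn0.
  rewrite leq_add2l leqn0 mxrank_eq0; apply/eqP/row_matrixP => i; rewrite row0.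
  have := row_sub i (P :&: kermx pr)%MS; set y := row i _.
  rewrite sub_capmx => /andP[yP /sub_kermxP]; rewrite prE => /eqP.
  rewrite subr_eq0; move: (hform y x / hform x x) => c /eqP yE.
  have := P0 _ yP; rewrite yE hformZl hformZr mulrA -normCK => h.
  suff -> : c = 0 by rewrite scale0r.
  apply/eqP; apply: contraTT h => c0.
  by rewrite -real_ltNge ?real0 ?realM ?hform_real ?realX ?normr_real//
    pmulr_rlt0// exprn_gt0// normr_gt0.
(* Here [x] is positive: it is added back to the space found in its orthogonal, which makes up for
   the dimension lost by [P]. *)
- have [||W [ZW WU [fW gW] W'0 rW]] :=
    IH U' Z (P :&: kermx (H *m x^t*))%MS (rU' _ xU x0) ZU' perp' fU' gU' fZ gZ.
  + exact: capmxS.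
  + by move=> y yP; apply: P0; exact: submx_trans yP (capmxSl _ _).
  have wx w : (w <= W)%MS -> hform w x = 0.
    by move=> wW; have := submx_trans wW WU; rewrite U'P => /andP[_ /eqP].
  exists (W + x)%MS; split.
  + exact: submx_trans ZW (addsmxSl _ _).
  + by rewrite addsmx_sub xU (submx_trans WU).
  + split; [exact: stable_add xf|exact: stable_add xg].
  + move=> y /sub_adds_rowP[w [c [wW ->]]].
    rewrite hformDl !hformDr !hformZl !hformZr (hformC x w) wx// conjC0.
    rewrite !mulr0 addr0 add0r mulrA -normCK addr_ge0 ?W'0//.
    by rewrite mulr_ge0 ?exprn_ge0// ltW.
  rewrite addsmx_row_rank; last by apply: contra x0 => /wx ->.
  by apply: leq_trans (cap_kermx_rank _ (H *m x^t*)) _; rewrite ltnS.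
Qed.
End Invariant.
End Hermitian.

(** * Traces on maximal nonnegative invariant subspaces *)

Lemma mxtrace_invariant (F : fieldType) (N p q : nat) (f : 'M[F]_N)
    (W : 'M[F]_(p, N)) (V : 'M[F]_(q, N)) M B :
  row_free W -> row_free V -> (W :=: V)%MS -> W *m f = M *m W ->
  V *m f = B *m V -> \tr M = \tr B.
Proof.
move=> fW fV eWV WM VB.
have /submxP[Q WQ] : (W <= V)%MS by rewrite eWV.
have /submxP[Q' VQ] : (V <= W)%MS by rewrite eWV.
have QQ' : Q *m Q' = 1%:M.
  by apply: (row_free_inj fW); rewrite -mulmxA -VQ -WQ mul1mx.
have Q'Q : Q' *m Q = 1%:M.
  by apply: (row_free_inj fV); rewrite -mulmxA -WQ -VQ mul1mx.
have e : M *m Q = Q *m B.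
  by apply: (row_free_inj fV); rewrite -mulmxA -WQ -WM {1}WQ -!mulmxA VB.
by rewrite -[M]mulmx1 -QQ' mulmxA e -mulmxA mxtrace_mulC -mulmxA Q'Q mulmx1.
Qed.

Section TraceUnique.
Variables (C : numClosedFieldType) (N n : nat) (H : 'M[C]_N).
Hypothesis hermH : H^t* = H.
Hypothesis max_nonneg : forall p (W : 'M[C]_(p, N)), nonneg H W ->
  (\rank W <= n)%N.
Variable f : 'M[C]_N.
Hypothesis hf : skewh H f.
Local Notation h := (hform H).

(** [W2 + x] is nonnegative, so maximality puts [x] in [W2]. Then [x] is isotropic, hence orthogonal
    to the nonnegative [W1]. *)
Lemma nonneg_max_perp (W1 W2 : 'M[C]_(n, N)) x : row_free W2 ->
  nonneg H W1 -> nonneg H W2 -> (x <= W1)%MS ->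
  (forall y, (y <= W2)%MS -> h x y = 0) ->
  (x <= W2)%MS /\ forall y, (y <= W1)%MS -> h x y = 0.
Proof.
move=> f2 n1 n2 x1 perp.
have x2 : (x <= W2)%MS.
  apply: contraT => nx; have : nonneg H (W2 + x)%MS.
    move=> y /sub_adds_rowP[w [c [wW ->]]].
    rewrite hformDl !(hformDr hermH) !hformZl !(hformZr hermH) (hformC hermH w
      x) perp//.
    rewrite conjC0 !mulr0 addr0 add0r mulrA -normCK addr_ge0 ?n2//.
    by rewrite mulr_ge0 ?exprn_ge0// n1.
  by move/max_nonneg; rewrite addsmx_row_rank// (eqP f2) ltnn.
by split=> // y y1; apply: (nonneg_isotropic hermH n1 x1 _ y1); exact: perp.
Qed.

Lemma gramE p q (A : 'M[C]_(p, N)) (B : 'M[C]_(q, N)) i j :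
  (A *m H *m B^t*) i j = h (row i A) (row j B).
Proof.
rewrite /hform -row_mul [LHS]mxE [RHS]mxE; apply: eq_bigr => k _.
by congr (_ * _); [rewrite [RHS]mxE|rewrite !mxE].
Qed.

Lemma gram_eq0 p q (A : 'M[C]_(p, N)) (B : 'M[C]_(q, N)) :
  (forall x y, (x <= A)%MS -> (y <= B)%MS -> h x y = 0) -> A *m H *m B^t* = 0.
Proof.
by move=> e; apply/matrixP => i j; rewrite gramE e ?row_sub// mxE.
Qed.

Lemma gram_eq0P p q (A : 'M[C]_(p, N)) (B : 'M[C]_(q, N)) x y :
  A *m H *m B^t* = 0 -> (x <= A)%MS -> (y <= B)%MS -> h x y = 0.
Proof.
move=> e /submxP[D ->] /submxP[E ->].
rewrite /hform trmx_mul map_mxM -(mulmxA D) -(mulmxA D) (mulmxA (A *m H)) e.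
by rewrite mul0mx mulmx0 mxE.
Qed.

Section Split.
Variable K : 'M[C]_N.
Hypothesis fK : (K *m f <= K)%MS.
Local Notation T := (row_base K).
Local Notation U W := (row_base (W :\: K)%MS).

Lemma split_base p (W : 'M[C]_(p, N)) : (K <= W)%MS ->
  (W :=: col_mx T (U W))%MS /\ row_free (col_mx T (U W)).
Proof.
move=> KW; have e : (W :=: col_mx T (U W))%MS.
  apply: eqmx_trans (addsmxE _ _).
  apply: eqmx_trans (adds_eqmx (eqmx_sym (eq_row_base K)) (eqmx_sym
    (eq_row_base _))).
  apply/eqmxP; rewrite addsmx_sub KW diffmxSl !andbT.
  have : (W <= (W :\: K) + (W :&: K))%MS by rewrite addsmx_diff_cap_eq.
  move/submx_trans; apply; rewrite addsmx_sub addsmxSr.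
  exact: submx_trans (capmxSr _ _) (addsmxSl _ _).
by split=> //; rewrite /row_free -e -(mxrank_cap_compl W K) (capmx_idPr KW).
Qed.

(** In a basis of [W] adapted to [K], the map [f] is block triangular. *)
Lemma split_trace p (W : 'M[C]_(p, N)) M : (K <= W)%MS -> row_free W ->
  W *m f = M *m W -> exists mT mU b,
  [/\ T *m f = mT *m T, U W *m f = b *m T + mU *m U W &
    \tr M = \tr mT + \tr mU].
Proof.
move=> KW fW WM; have [e fc] := split_base KW.
have /submxP[mT eT] : (T *m f <= T)%MS.
  by rewrite (eqmxMr f (eq_row_base K)) eq_row_base.
have sW : (W *m f <= W)%MS by rewrite WM submxMl.
have : (U W *m f <= col_mx T (U W))%MS.
  rewrite (eqmxMr f (eq_row_base _)) -e (submx_trans _ sW)//.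
  exact: submxMr (diffmxSl _ _).
move=> /submxP[D]; rewrite -[D]hsubmxK mul_row_col => eU.
exists mT, (rsubmx D), (lsubmx D); split=> //.
rewrite -(mxtrace_block mT 0 (lsubmx D)); apply: mxtrace_invariant fW fc e WM _.
by rewrite mul_block_col mul0mx addr0 -eU -eT mul_col_mx.
Qed.

End Split.

(* The Gram matrix [G] of [W1] and [W2] satisfies [M1 G = - G M2^*]. It may be
   singular, but its kernel is the common isotropic subspace [K] of [W1] and
   [W2], on which the two traces agree. *)
Lemma trace_nonneg_invariant (W1 W2 : 'M[C]_(n, N)) (M1 M2 : 'M[C]_n) :
  row_free W1 -> row_free W2 -> nonneg H W1 -> nonneg H W2 ->
  W1 *m f = M1 *m W1 -> W2 *m f = M2 *m W2 ->
  exists t, \tr M1 + (\tr M2)^* = t + t^*.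
Proof.
move=> f1 f2 n1 n2 WM1 WM2.
pose K := (W1 :&: kermx (H *m W2^t*))%MS.
have KP x : (x <= K)%MS <-> (x <= W1)%MS /\ forall y, (y <= W2)%MS -> h x y = 0.
  rewrite sub_capmx; split=> [/andP[x1 /sub_kermxP e]|[x1 e]].
    by split=> // y y2; apply: (gram_eq0P (A := x) (B := W2));
      rewrite // -mulmxA.
  rewrite x1; apply/sub_kermxP; rewrite mulmxA; apply: gram_eq0 =>
    _ y /sub_rVP[c ->] y2.
  by rewrite hformZl e ?mulr0.
have KP2 x : (x <= K)%MS -> (x <= W2)%MS /\ forall y, (y <= W1)%MS -> h x y = 0.
  by move=> /KP[x1 e]; apply: nonneg_max_perp n2 x1 e.
have KP3 x : (x <= W2)%MS -> (forall y, (y <= W1)%MS -> h x y = 0) ->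
  (x <= K)%MS.
  by move=> x2 e; apply/KP; apply: nonneg_max_perp n1 x2 e.
have s1 : (W1 *m f <= W1)%MS by rewrite WM1 submxMl.
have s2 : (W2 *m f <= W2)%MS by rewrite WM2 submxMl.
have sK : (K *m f <= K)%MS.
  apply: stable_subP => x /KP[x1 e]; apply/KP; split; first exact: stable_sub.
  by move=> y y2; rewrite skewhE// e ?oppr0// stable_sub.
have KW1 : (K <= W1)%MS by exact: capmxSl.
have KW2 : (K <= W2)%MS.
  by apply/row_subP => i; apply: (KP2 _ _).1; exact: row_sub.
have [mT [m1 [b1 [eT e1 ->]]]] := split_trace sK KW1 f1 WM1.
have [mT' [m2 [b2 [eT' e2 ->]]]] := split_trace sK KW2 f2 WM2.
have -> : mT' = mT by apply: (row_free_inj (row_base_free K)); rewrite -eT'.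
set U1 := row_base _ in e1; set U2 := row_base _ in e2; set T :=
  row_base K in eT e1 e2.
have UW1 : (U1 <= W1)%MS by rewrite eq_row_base diffmxSl.
have UW2 : (U2 <= W2)%MS by rewrite eq_row_base diffmxSl.
have TP x : (x <= T)%MS -> (x <= K)%MS by rewrite eq_row_base.
pose G := U1 *m H *m U2^t*.
have GT : T *m H *m U2^t* = 0.
  apply: gram_eq0 => x y /TP /KP[_ e] y2; apply: e; exact: submx_trans UW2.
have TG : U1 *m H *m T^t* = 0.
  apply: gram_eq0 => x y x1 /TP /KP2[_ e]; rewrite (hformC hermH) e ?conjC0//.
  exact: submx_trans UW1.
(* This is skewness of [f]; the blocks [b1] and [b2] drop out because [K] is orthogonal to both
   complements. *)
have mG : m1 *m G = - (G *m m2^t*).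
  have : U1 *m f *m H *m U2^t* = m1 *m G.
    by rewrite e1 !mulmxDl -!(mulmxA b1) GT mulmx0 add0r -!(mulmxA m1).
  move=> <-; rewrite -(mulmxA U1) hf mulmxN mulNmx; congr (- _).
  have -> : U1 *m (H *m f^t*) *m U2^t* = U1 *m H *m (U2 *m f)^t*.
    by rewrite [(U2 *m f)^T]trmx_mul map_mxM !mulmxA.
  rewrite e2 [(_ + _)^T]linearD /= map_mxD [(b2 *m T)^T]trmx_mul.
  rewrite [(m2 *m U2)^T]trmx_mul !map_mxM mulmxDr.
  by rewrite (mulmxA _ (T^t*)) TG mul0mx add0r mulmxA.
have free_gram (V1 V2 : 'M[C]_(n, N)) :
  (K <= V2)%MS ->
  (forall x, (x <= V1)%MS -> (forall y, (y <= V2)%MS -> h x y = 0) ->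
    (x <= K)%MS) ->
  (forall x y, (x <= K)%MS -> (y <= V1)%MS -> h x y = 0) ->
  row_free (row_base (V1 :\: K)%MS *m H *m (row_base (V2 :\: K)%MS)^t*).
  move=> KV2 hK K1; rewrite -kermx_eq0; apply/eqP/row_matrixP => i;
    rewrite row0.
  set p := row i _.
  have pG : p *m (row_base (V1 :\: K)%MS *m H *m (row_base (V2 :\:
    K)%MS)^t*) = 0.
    by apply/sub_kermxP; exact: row_sub.
  set x := p *m row_base (V1 :\: K)%MS.
  have xD : (x <= V1 :\: K)%MS by rewrite (submx_trans (submxMl _ _))//
    eq_row_base.
  have x1 : (x <= V1)%MS by exact: submx_trans xD (diffmxSl _ _).
  have xK : (x <= K)%MS.
    apply: hK => // y; rewrite (split_base KV2).1 => /submxP[D ->].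
    rewrite -[D]hsubmxK mul_row_col (hformDr hermH).
    rewrite (hformC hermH) K1 ?conjC0 ?add0r//; last first.
      by rewrite (submx_trans (submxMl _ _))// eq_row_base.
    apply: (gram_eq0P (A := x) (B := row_base (V2 :\: K)%MS));
      rewrite ?submxMl//.
    by rewrite -!mulmxA -[RHS]pG !mulmxA.
  have : (x <= (V1 :\: K) :&: K)%MS by rewrite sub_capmx xD.
  rewrite capmx_diff submx0 => /eqP x0.
  by apply: (row_free_inj (row_base_free (V1 :\: K)%MS)); rewrite -/x x0 mul0mx.
have G1 : G *m pinvmx G = 1%:M.
  apply: mulmxVp; apply: free_gram => //; first by move=> x x1 e; apply/KP.
  by move=> x y /KP2[_ e]; exact: e.
(* The two dimensions of [G] are different expressions, so a left inverse is obtained separately,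
   from the adjoint of [G]. *)
have G2 : exists R, R *m G = 1%:M.
  have fG : row_free (U2 *m H *m U1^t*).
    by apply: free_gram => // x y /KP[_ e]; exact: e.
  exists ((pinvmx (U2 *m H *m U1^t*))^t*).
  have -> : G = ((U2 *m H *m U1^t*)^t*).
    by apply/matrixP => i j; rewrite [LHS]gramE [RHS]mxE [in RHS]mxE gramE
      (hformC hermH).
  by rewrite -map_mxM -trmx_mul mulmxVp// trmx1 map_mx1.
have G3 : pinvmx G *m G = 1%:M.
  have [R RG] := G2.
  by rewrite -[LHS]mul1mx -{1}RG mulmxA -(mulmxA R) G1 mulmx1.
exists (\tr mT).
have tr1 : \tr m1 = - (\tr m2)^*.
  rewrite -[m1]mulmx1 -G1 mulmxA mG mulNmx linearN /= -mulmxA mxtrace_mulC.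
  by rewrite -mulmxA G3 mulmx1 trace_map_mx mxtrace_tr.
by rewrite tr1 rmorphD addrACA addNr addr0.
Qed.

End TraceUnique.

(** * The Maslov quasi-state *)

Section Maslov.
Variables (R : realType) (n : nat).
Local Notation C := R[i].
Local Notation N := (n + n)%N.
Local Notation cx := (map_mx (real_complex R)).
Local Notation JC := (symp_form C n).
Local Notation "'j" := ('i%C : C) (at level 0).

Definition herm_symp : 'M[C]_N := 'j *: JC.
Local Notation H := herm_symp.
Local Notation h := (hform H).

Lemma conj_cx p q (A : 'M[R]_(p, q)) : (cx A)^t* = cx A^T.
Proof. by apply/matrixP => i k; rewrite !mxE; apply: conjc_real. Qed.

Lemma conj_i : Num.conj 'j = - 'j.
Proof. by apply/eqP; rewrite eq_complex /= oppr0 !eqxx. Qed.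

Lemma sqr_j : 'j * 'j = -1.
Proof. by rewrite -expr2 sqr_i. Qed.

Lemma herm_symp_hermitian : H^t* = H.
Proof.
rewrite /herm_symp linearZ /= map_mxZ /= conj_i -cx_symp_form conj_cx
  tr_symp_form.
by rewrite map_mxN scalerN scaleNr opprK.
Qed.

Lemma sp_skewh (A : 'M[R]_N) : A \in sp_space R n -> skewh H (cx A).
Proof.
move=> /sp_spaceP hA; rewrite /skewh conj_cx /herm_symp -cx_symp_form.
rewrite -!scalemxAr -!scalemxAl -!map_mxM -scalerN -map_mxN; congr (_ *: cx _).
set J := symp_form R n in hA *.
have : J *m (A^T *m J + J *m A) *m J = 0 by rewrite hA mulmx0 mul0mx.
rewrite mulmxDr mulmxDl !mulmxA -(mulmxA (J *m A^T)) symp_form_sqr.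
rewrite mulmxN mulmx1 mulNmx mul1mx mulNmx => /eqP.
by rewrite addrC -opprD oppr_eq0 addr_eq0 => /eqP.
Qed.

Lemma hform_row (p q : 'rV[C]_n) :
  h (row_mx p q) (row_mx p q) = 'j * ((p *m q^t*) 0 0 - (q *m p^t*) 0 0).
Proof.
rewrite /hform /herm_symp -scalemxAr -scalemxAl mxE; congr (_ * _).
rewrite /symp_form mul_row_block !mulmx0 !mulmx1 add0r addr0 mulmxN mulmx1.
by rewrite tr_row_mx map_col_mx mul_row_col mulNmx !mxE addrC.
Qed.

Lemma dot_ge0 (p : 'rV[C]_n) : 0 <= (p *m p^t*) 0 0 ?= iff (p == 0).
Proof.
have e : (p *m p^t*) 0 0 = \sum_i `|p 0 i| ^+ 2.
  by rewrite mxE; apply: eq_bigr => i _; rewrite !mxE -normCK.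
split; first by rewrite e sumr_ge0// => i _; rewrite exprn_ge0.
apply/idP/idP => [|/eqP ->]; last by rewrite mul0mx mxE.
rewrite e eq_sym psumr_eq0 => [/allP z|i _]; last by rewrite exprn_ge0.
apply/eqP/rowP => i; rewrite [RHS]mxE; apply/eqP.
by have := z i (mem_index_enum _); rewrite /= sqrf_eq0 normr_eq0.
Qed.

Lemma scalemx00 (c : C) (M : 'M[C]_1) : (c *: M) 0 0 = c * M 0 0.
Proof. by rewrite mxE. Qed.

(** The vectors [(a, - i a)] form a negative definite space [V] of dimension [n], which meets [W]
    trivially. *)
Lemma nonneg_rank p (W : 'M[C]_(p, N)) : nonneg H W -> (\rank W <= n)%N.
Proof.
move=> W0; pose V : 'M[C]_(n, N) := row_mx 1%:M (- 'j)%:M.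
have rV : \rank V = n.
  apply/eqP/row_freeP; exists (col_mx 1%:M 0).
  by rewrite mul_row_col mulmx1 mulmx0 addr0.
have cap0 : (W :&: V)%MS = 0.
  apply/row_matrixP => k; rewrite row0.
  have := row_sub k (W :&: V)%MS; set x := row k _.
  rewrite sub_capmx => /andP[/W0 + /submxP[a xa]]; rewrite xa.
  rewrite mul_mx_row mulmx1 mul_mx_scalar hform_row.
  rewrite linearZ /= map_mxZ /= -scalemxAr -scalemxAl !scalemx00 rmorphN /=
    conj_i opprK.
  have -> (c : C) : 'j * ('j * c - - 'j * c) = - 2 * c.
    by transitivity (('j * 'j) * 2 * c); [ring|rewrite sqr_j; ring].
  rewrite mulNr oppr_ge0 pmulr_rle0 ?ltr0n// => a0.
  have [a1 a2] := dot_ge0 a.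
  have : 0 == (a *m a^t*) 0 0 by rewrite eq_le a1 a0.
  by rewrite a2 => /eqP ->; rewrite scaler0 row_mx0.
have := mxrank_sum_cap W V; rewrite cap0 mxrank0 addn0 rV => e.
by have := rank_leq_col (W + V)%MS; rewrite e leq_add2r.
Qed.

Definition maslov_rel (A : 'M[R]_N) (t : R) :=
  exists W M, [/\ row_free (W : 'M[C]_(n, N)), nonneg H W, W *m cx A = M *m W &
    t = complex.Im (\tr M)].

Lemma maslov_uniq A s t : A \in sp_space R n ->
  maslov_rel A s -> maslov_rel A t -> s = t.
Proof.
move=> hA [W [M [f1 n1 e1 ->]]] [V [M' [f2 n2 e2 ->]]].
have [c hc] := trace_nonneg_invariant herm_symp_hermitian nonneg_rank
  (sp_skewh hA) f1 f2 n1 n2 e1 e2.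
have := congr1 (@complex.Im R) hc.
case: (\tr M) (\tr M') c {hc} => [? x] [? y] [? u] /=.
by rewrite subrr => /eqP; rewrite subr_eq0 => /eqP.
Qed.

Lemma row_free_rank p q k (W : 'M[C]_(p, q)) : \rank W = k ->
  exists2 V : 'M[C]_(k, q), row_free V & (V :=: W)%MS.
Proof.
by move=> <-; exists (row_base W); [exact: row_base_free|exact: eq_row_base].
Qed.

Lemma maslov_common A B : A \in sp_space R n -> B \in sp_space R n ->
  A *m B = B *m A ->
  exists W MA MB, [/\ row_free (W : 'M[C]_(n, N)), nonneg H W,
    W *m cx A = MA *m W & W *m cx B = MB *m W].
Proof.
(* The vectors [(a, i a)] form a positive definite space of dimension [n]; it only serves to force
   the invariant space to have rank [n]. *)
move=> hA hB cAB; pose P : 'M[C]_(n, N) := row_mx 1%:M 'j%:M.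
have rP : \rank P = n.
  apply/eqP/row_freeP; exists (col_mx 1%:M 0).
  by rewrite mul_row_col mulmx1 mulmx0 addr0.
have P0 : nonneg H <<P>>%MS.
  move=> x; rewrite genmxE => /submxP[a ->].
  rewrite mul_mx_row mulmx1 mul_mx_scalar hform_row.
  rewrite linearZ /= map_mxZ /= -scalemxAr -scalemxAl !scalemx00 conj_i.
  have -> (c : C) : 'j * (- 'j * c - 'j * c) = 2 * c.
    by transitivity (- ('j * 'j) * 2 * c); [ring|rewrite sqr_j; ring].
  by rewrite mulr_ge0 ?ler0n//; have [] := dot_ge0 a.
have cfg : cx A *m cx B = cx B *m cx A by rewrite -!map_mxM cAB.
have [|||||||||W [_ _ [sA sB] W0 rW]] := @nonneg_invariant_ext C N H
  herm_symp_hermitian (cx A) (cx B) cfg (sp_skewh hA) (sp_skewh hB)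
  N 1%:M 0 <<P>>%MS; rewrite ?mul0mx ?sub0mx ?submx1//.
- by rewrite mxrank0 rank_leq_row.
- by move=> u v; rewrite submx0 => /eqP ->; rewrite hform0l.
have rW' : \rank W = n.
  apply/eqP; rewrite eqn_leq nonneg_rank//=.
  by rewrite -[X in (X <= _)%N]rP -(genmxE P).
have [V fV VW] := row_free_rank rW'.
have st (D : 'M[C]_N) : (W *m D <= W)%MS -> exists M, V *m D = M *m V.
  by move=> s; apply/submxP; rewrite (eqmxMr D VW) VW.
have [MA eA] := st _ sA; have [MB eB] := st _ sB.
exists V, MA, MB; split=> // x; rewrite VW; exact: W0.
Qed.

(* Off sp(2n), the junk value [0] may occur. *)
Definition maslov (A : 'M[R]_N) : R := xget 0 (maslov_rel A).

Lemma maslovE A t : A \in sp_space R n -> maslov_rel A t -> maslov A = t.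
Proof.
move=> hA ht; rewrite /maslov; case: xgetP => [s _ hs|/(_ t)//].
exact: maslov_uniq hs ht.
Qed.

Lemma maslov_linear A B : A \in sp_space R n -> B \in sp_space R n ->
  A *m B = B *m A -> forall c d,
  maslov (c *: A + d *: B) = c * maslov A + d * maslov B.
Proof.
move=> hA hB cAB c d; have [W [MA [MB [fW W0 eA eB]]]] :=
  maslov_common hA hB cAB.
rewrite (@maslovE A (complex.Im (\tr MA)))//; last by exists W, MA.
rewrite (@maslovE B (complex.Im (\tr MB)))//; last by exists W, MB.
apply: maslovE; first by rewrite memvD// memvZ.
exists W, (c%:C%C *: MA + d%:C%C *: MB); split=> //.
  rewrite map_mxD !map_mxZ /= mulmxDr -!scalemxAr eA eB mulmxDl -!scalemxAl.
  by [].
rewrite mxtraceD !mxtraceZ; case: (\tr MA) (\tr MB) => [? ?] [? ?] /=; ring.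
Qed.

End Maslov.

(** * Continuity of complex matrix functions *)

Section ComplexContinuity.
Variables (R : realType) (T : topologicalType).
Local Notation C := R[i].
Local Notation cx := (map_mx (real_complex R)).

Definition ccont p q (F : T -> 'M[C]_(p, q)) := forall i j,
  continuous (fun t => complex.Re (F t i j)) /\
  continuous (fun t => complex.Im (F t i j)).

Lemma Re_sum (I : Type) (r : seq I) (f : I -> C) :
  complex.Re (\sum_(i <- r) f i) = \sum_(i <- r) complex.Re (f i).
Proof. by apply: (big_morph (@complex.Re R)) => // -[? ?] [? ?]. Qed.

Lemma Im_sum (I : Type) (r : seq I) (f : I -> C) :
  complex.Im (\sum_(i <- r) f i) = \sum_(i <- r) complex.Im (f i).
Proof. by apply: (big_morph (@complex.Im R)) => // -[? ?] [? ?]. Qed.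

Lemma ReM (x y : C) : complex.Re (x * y) =
  complex.Re x * complex.Re y - complex.Im x * complex.Im y.
Proof. by case: x y => [? ?] [? ?]. Qed.
Lemma ImM (x y : C) : complex.Im (x * y) =
  complex.Re x * complex.Im y + complex.Im x * complex.Re y.
Proof. by case: x y => [? ?] [? ?]. Qed.
Lemma ReD (x y : C) : complex.Re (x + y) = complex.Re x + complex.Re y.
Proof. by case: x y => [? ?] [? ?]. Qed.
Lemma ImD (x y : C) : complex.Im (x + y) = complex.Im x + complex.Im y.
Proof. by case: x y => [? ?] [? ?]. Qed.

Lemma ccont_cst p q (M : 'M[C]_(p, q)) : ccont (fun=> M).
Proof. by move=> i j; split; exact: cst_continuous. Qed.

Lemma ccont_cx p q (F : T -> 'M[R]_(p, q)) :
  (forall i j, continuous (fun t => F t i j)) -> ccont (fun t => cx (F t)).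
Proof.
move=> cF i j; split; under [X in continuous X]funext do rewrite mxE /=.
  exact: cF.
exact: cst_continuous.
Qed.

Lemma ccontD p q (F G : T -> 'M[C]_(p, q)) :
  ccont F -> ccont G -> ccont (fun t => F t + G t).
Proof.
move=> cF cG i j; split.
  under [X in continuous X]funext do rewrite mxE ReD.
  by apply: continuous_addr; [exact: (cF i j).1|exact: (cG i j).1].
under [X in continuous X]funext do rewrite mxE ImD.
by apply: continuous_addr; [exact: (cF i j).2|exact: (cG i j).2].
Qed.

Lemma ccontM p q r (F : T -> 'M[C]_(p, q)) (G : T -> 'M[C]_(q, r)) :
  ccont F -> ccont G -> ccont (fun t => F t *m G t).
Proof.
move=> cF cG i j; split.
  under [X in continuous X]funext do rewrite mxE Re_sum.
  apply: continuous_sumr => k; under [X in continuous X]funext do rewrite ReM.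
  apply: continuous_subr; apply: continuous_mulr.
  - exact: (cF i k).1.
  - exact: (cG k j).1.
  - exact: (cF i k).2.
  - exact: (cG k j).2.
under [X in continuous X]funext do rewrite mxE Im_sum.
apply: continuous_sumr => k; under [X in continuous X]funext do rewrite ImM.
apply: continuous_addr; apply: continuous_mulr.
- exact: (cF i k).1.
- exact: (cG k j).2.
- exact: (cF i k).2.
- exact: (cG k j).1.
Qed.

Lemma ccont_adj p q (F : T -> 'M[C]_(p, q)) :
  ccont F -> ccont (fun t => (F t)^t*).
Proof.
move=> cF i j; split.
  have -> : (fun t => complex.Re (((F t)^t*) i j)) =
      (fun t => complex.Re (F t j i)).
    by apply/funext => t; rewrite !mxE; case: (F t j i).
  exact: (cF j i).1.
have -> : (fun t => complex.Im (((F t)^t*) i j)) =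
    (fun t => - complex.Im (F t j i)).
  by apply/funext => t; rewrite !mxE; case: (F t j i).
exact/continuous_oppr/(cF j i).2.
Qed.

Lemma ccont_near_neq0 p q (F : T -> 'M[C]_(p, q)) t :
  ccont F -> F t <> 0 -> nbhs t (fun s => F s <> 0).
Proof.
move=> cF Ft; have [i [j hij]] : exists i j, F t i j <> 0.
  apply: contrapT => h; apply: Ft; apply/matrixP => i j; rewrite mxE.
  by apply: contrapT => hij; apply: h; exists i, j.
have op : open [set~ (0 : R)] by exact/closed_openC/closed_eq.
have [hr|hr] := pselect (complex.Re (F t i j) = 0); last first.
  have := near_continuous op (cF i j).1 hr.
  by apply: filterS => s /= hs e; apply: hs; rewrite e mxE.
have hi : complex.Im (F t i j) <> 0.
  by move=> hi; apply: hij; case: (F t i j) hr hi => x y /= -> ->.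
have := near_continuous op (cF i j).2 hi.
by apply: filterS => s /= hs e; apply: hs; rewrite e mxE.
Qed.

End ComplexContinuity.

(** * Continuity of the Maslov quasi-state *)

Section MaslovContinuity.
Variables (R : realType) (n : nat).
Local Notation C := R[i].
Local Notation N := (n + n)%N.
Local Notation cx := (map_mx (real_complex R)).
Local Notation H := (@herm_symp R n).
Local Notation h := (hform H).

(** An orthonormal basis, for the standard hermitian product, of a nonnegative invariant subspace.
    The conditions are equations to 0 and weak inequalities, so that their failure is open. *)
Definition frame (A : 'M[R]_N) (V : 'M[C]_(n, N)) :=
  [/\ V *m V^t* - 1%:M = 0, V *m cx A - V *m cx A *m V^t* *m V = 0 &
    forall p : 'rV_n, 0 <= complex.Re ((p *m V *m H *m V^t* *m p^t*) 0 0)].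

Definition frame_trace (A : 'M[R]_N) (V : 'M[C]_(n, N)) : R :=
  complex.Im (\tr (V *m cx A *m V^t*)).

Lemma frame_maslov A V : A \in sp_space R n -> frame A V ->
  maslov A = frame_trace A V.
Proof.
move=> hA [/eqP e1 /eqP e2 V0]; rewrite subr_eq0 in e1; rewrite subr_eq0 in e2.
apply: maslovE => //; exists V, (V *m cx A *m V^t*); split=> //.
- by rewrite /row_free mxrank_unitary// qualifE.
- move=> x /submxP[p ->].
  have e : h (p *m V) (p *m V) = (p *m V *m H *m V^t* *m p^t*) 0 0.
    by rewrite /hform trmx_mul map_mxM !mulmxA.
  have := V0 p; rewrite -e => h0.
  rewrite -(RRe_real (hform_real (@herm_symp_hermitian R n) (p *m V))).
  by rewrite ler0c.
- exact/eqP.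
Qed.

Lemma frame_exists A : A \in sp_space R n -> exists V, frame A V.
Proof.
move=> hA; have [W [M [_ [fW W0 e _]]]] := maslov_common hA hA erefl.
have nN : (n <= N)%N by rewrite leq_addr.
pose V := schmidt W.
have uV : V *m V^t* = 1%:M by apply/eqP; have := schmidt_unitarymx W nN;
  rewrite qualifE.
have VW : (V :=: W)%MS by exact: eqmx_schmidt_free.
exists V; split.
- by rewrite uV subrr.
- have /submxP[D VD] : (V *m cx A <= V)%MS.
    by rewrite (eqmxMr _ VW) VW e submxMl.
  by rewrite VD -(mulmxA D) uV mulmx1 subrr.
- move=> p; have := W0 (p *m V); rewrite -VW submxMl => /(_ isT).
  rewrite /hform trmx_mul map_mxM !mulmxA lecE => /andP[_].
  by [].
Qed.

Local Notation L := (n * N)%N.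

(** Frames are coded by real vectors, so that orthonormal ones come from a compact real cube. *)
Definition frame_of (v : 'rV[R]_(L + L)) : 'M[C]_(n, N) :=
  cx (vec_mx (lsubmx v)) + 'i%C%:M *m cx (vec_mx (rsubmx v)).

Definition frame_code (V : 'M[C]_(n, N)) : 'rV[R]_(L + L) :=
  row_mx (mxvec (map_mx (@complex.Re R) V)) (mxvec (map_mx (@complex.Im R) V)).

Lemma frame_codeK V : frame_of (frame_code V) = V.
Proof.
rewrite /frame_of /frame_code row_mxKl row_mxKr !mxvecK mul_scalar_mx.
by apply/matrixP => i j; rewrite !mxE -complexE.
Qed.

Lemma unitary_entry_le1 (V : 'M[C]_(n, N)) i j : V *m V^t* = 1%:M ->
  complex.Re (V i j) ^+ 2 + complex.Im (V i j) ^+ 2 <= 1.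
Proof.
move=> uV; have : (V *m V^t*) i i = 1 by rewrite uV mxE eqxx.
rewrite mxE => e.
have e' (k : 'I_N) : V i k * (V^t*) k i = (complex.Re (V i k) ^+ 2 + complex.Im
  (V i k) ^+ 2)%:C%C.
  by rewrite add_Re2_Im2 !mxE -normCK.
have {}e : \sum_k (complex.Re (V i k) ^+ 2 + complex.Im (V i k) ^+ 2) = 1.
  apply: (@complexI R); rewrite rmorph_sum /= -[RHS]e.
  by apply: eq_bigr => k _; rewrite e'.
rewrite -e (bigD1 j)//= lerDl sumr_ge0// => k _.
by rewrite addr_ge0 ?sqr_ge0.
Qed.

Definition codes : set 'rV[R]_(L + L) := [set v | forall i, `[(-1 :
  R), 1]%classic (v ord0 i)].

Lemma codes_compact : compact codes.
Proof.
exact: (@rV_compact R (L + L) (fun=> `[(-1 : R), 1]%classic)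
  (fun=> @segment_compact R (-1) 1)).
Qed.

Lemma frame_code_codes (V : 'M[C]_(n, N)) : V *m V^t* = 1%:M ->
  codes (frame_code V).
Proof.
move=> uV i; rewrite /frame_code mxE.
have bnd (a b : R) : a ^+ 2 + b ^+ 2 <= 1 -> `[(-1 :
  R), 1]%classic a /\ `[(-1 : R), 1]%classic b.
  by move=> ab; rewrite /= !in_itv /=; split; apply/andP; split; nra.
case: split_ordP => k _; case/mxvec_indexP: k => a b; rewrite mxvecE mxE.
  by have [] := bnd _ _ (unitary_entry_le1 a b uV).
by have [] := bnd _ _ (unitary_entry_le1 a b uV).
Qed.

(* Compactness is used as a near-covering: near any code [v] and close to [u0],
   a pair is not a frame or has a trace close to the Maslov value at [u0]. *)
Lemma maslov_continuous_path (d : nat) (A : 'rV[R]_d -> 'M[R]_N) :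
  (forall i j, continuous (fun u => A u i j)) ->
  (forall u, A u \in sp_space R n) -> continuous (fun u => maslov (A u)).
Proof.
move=> cA spA u0.
apply/(@cvgrPdist_lt R R^o _ _ (nbhs_filter u0)) => e e0.
pose P u v := frame (A u) (frame_of v) ->
  `|maslov (A u0) - frame_trace (A u) (frame_of v)| < e.
have near : \forall u \near u0, codes `<=` P u.
  have /compact_near_coveringP ncov := codes_compact.
  apply: (ncov _ (nbhs u0) P (nbhs_filter u0)) => v _.
  pose T := ('rV[R]_(L + L) * 'rV[R]_d)%type.
  suff : nbhs ((v, u0) : T) (fun t : T => P t.2 t.1) by [].
  have cA' : ccont (fun t : T => cx (A t.2)).
    apply: ccont_cx => i j t.
    apply: (@continuous_comp _ _ _ snd (fun u => A u i j)); last exact: cA.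
    exact: cvg_snd.
  have cV : ccont (fun t : T => frame_of t.1).
    have coord (k : 'I_(L + L)) : continuous (fun t : T => t.1 0 k).
      move=> t; apply: (@continuous_comp _ _ _ fst (fun w : 'rV[R]_(L + L) =>
        w 0 k)).
        exact: cvg_fst.
      exact: coord_continuous.
    apply: ccontD; last apply: ccontM.
    - apply: ccont_cx => i j.
      have -> : (fun t : T => vec_mx (lsubmx t.1) i j) =
          (fun t : T => t.1 0 (lshift L (mxvec_index i j))).
        by apply/funext => t; rewrite !mxE.
      exact: coord.
    - exact: ccont_cst.
    - apply: ccont_cx => i j.
      have -> : (fun t : T => vec_mx (rsubmx t.1) i j) =
          (fun t : T => t.1 0 (rshift L (mxvec_index i j))).
        by apply/funext => t; rewrite !mxE.
      exact: coord.
  have cVa := ccont_adj cV.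
  have cM := ccontM (ccontM cV cA') cVa.
  have [fr|nf] := pselect (frame (A u0) (frame_of v)).
    have ctr : continuous (fun t : T => frame_trace (A t.2) (frame_of t.1)).
      rewrite /frame_trace /mxtrace.
      under [X in continuous X]funext do rewrite Im_sum.
      by apply: continuous_sumr => i; exact: (cM i i).2.
    have := near_continuous (ball_open (frame_trace (A u0) (frame_of v)) e) ctr
      (t := (v, u0)) (ballxx _ e0).
    apply: filterS => -[w u] /= hb _.
    by rewrite (frame_maslov (spA u0) fr).
  (* When [v] does not code a frame of [A u0], one of the three conditions fails there and nearby,
     so [P] holds vacuously. *)
  have impl (Q : T -> Prop) : (forall t, frame (A t.2) (frame_of t.1) -> Q t) ->
      nbhs (v, u0) (fun t => ~ Q t) ->
      nbhs (v, u0) (fun t : T => P t.2 t.1).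
    by move=> hQ; apply: filterS => t nQ fr; case: nQ; exact: hQ.
  pose F1 (t : T) := frame_of t.1 *m (frame_of t.1)^t* + (- 1%:M) : 'M[C]_n.
  pose F2 (t : T) := frame_of t.1 *m cx (A t.2) +
    (- 1%:M) *m (frame_of t.1 *m cx (A t.2) *m (frame_of t.1)^t* *m frame_of t.1).
  have [h1|h1] := pselect (F1 (v, u0) = 0); last first.
    apply: (impl (fun t => F1 t = 0)); first by move=> t [].
    apply: ccont_near_neq0 h1; apply: ccontD; last exact: ccont_cst.
    exact: ccontM.
  have [h2|h2] := pselect (F2 (v, u0) = 0); last first.
    apply: (impl (fun t => F2 t = 0)).
      by move=> t [_ h _]; rewrite /F2 mulNmx mul1mx.
    apply: ccont_near_neq0 h2; apply: ccontD; first exact: ccontM.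
    by apply: ccontM; [exact: ccont_cst|exact: ccontM].
  have [p hp] : exists p : 'rV_n, ~ 0 <= complex.Re ((p *m frame_of v *m H *m
      (frame_of v)^t* *m p^t*) 0 0).
    apply: contrapT => nex; apply: nf; split.
    - exact: h1.
    - by rewrite -[RHS]h2 /F2 mulNmx mul1mx.
    - by move=> p; apply: contrapT => hp; apply: nex; exists p.
  pose F3 (t : T) := p *m frame_of t.1 *m H *m (frame_of t.1)^t* *m p^t* :
    'M[C]_1.
  apply: (impl (fun t => 0 <= complex.Re (F3 t 0 0))).
    by move=> t [_ _ h]; exact: h.
  have c3 : ccont F3.
    apply: ccontM; last exact: ccont_cst.
    apply: ccontM cVa; apply: ccontM; last exact: ccont_cst.
    by apply: ccontM cV; exact: ccont_cst.
  have lt0 : (fun x : R => x < 0) (complex.Re (F3 (v, u0) 0 0)).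
    by rewrite /= ltNge; exact/negP.
  have := near_continuous (@open_lt R 0) (c3 0 0).1 lt0.
  by apply: filterS => t /=; rewrite ltNge => /negP.
near=> u.
have [V fV] := frame_exists (spA u).
have uV : V *m V^t* = 1%:M by case: fV => /eqP; rewrite subr_eq0 => /eqP.
rewrite (frame_maslov (spA u) fV) -(frame_codeK V).
have : codes `<=` P u by near: u.
move=> /(_ _ (frame_code_codes uV)); apply.
by rewrite frame_codeK.
Unshelve. all: by end_near.
Qed.
End MaslovContinuity.

(** * Symmetric matrices and sp(2n, R) *)

Section Assembly.
Variables (R : realType) (n : nat).
Local Notation m := (n + n)%N.
Local Notation J := (symp_form R n).
Local Notation g := (sp R n).

Lemma symp_mul_sp (S : 'M[R]_m) : S^T = S -> J *m S \in sp_space R n.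
Proof.
move=> hS; apply/sp_spaceP; rewrite trmx_mul hS tr_symp_form mulmxN mulNmx.
by rewrite -(mulmxA S) (mulmxA J) symp_form_sqr mulmxN mulmx1 mulNmx mul1mx
  opprK subrr.
Qed.

Lemma sp_symp_mul (A : 'M[R]_m) : A \in sp_space R n ->
  (- (J *m A))^T = - (J *m A).
Proof.
move=> /sp_spaceP/eqP; rewrite addr_eq0 => /eqP h.
by rewrite linearN /= trmx_mul tr_symp_form mulmxN h !opprK.
Qed.

(** The projection makes the map total and linear on all matrices; it acts as the identity when [S]
    is symmetric. *)
Definition of_sym (S : 'M[R]_m) : g := vsproj (sp_space R n) (J *m S).

Lemma val_of_sym S : S^T = S -> vsval (of_sym S) = J *m S.
Proof. by move=> hS; rewrite vsprojK// symp_mul_sp. Qed.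

Lemma of_symK (X : g) : of_sym (- (J *m vsval X)) = X.
Proof.
by rewrite /of_sym mulmxN mulmxA symp_form_sqr mulNmx mul1mx opprK vsvalK.
Qed.

Lemma quasi_state_sym_quasi (q : quasi_state g) :
  sym_quasi (fun S => q (of_sym S)).
Proof.
have /asboolP[hq cq] := quasi_stateP q; split.
  set e := vbasis {: g}; have eB : basis_of {: g} e := vbasisP _.
  pose F (S : 'M[R]_m) := rVof e (of_sym S).
  have Fl : linear F.
    move=> a S T; rewrite /F /of_sym mulmxDr -scalemxAr.
    by rewrite !linearP.
  pose L : {linear 'M[R]_m -> 'rV[R]_(\dim {: g})} :=
    HB.pack F (GRing.isLinear.Build R _ _ _ F Fl).
  have -> : (fun S => q (of_sym S)) = (fun v => q (vecof e v)) \o L.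
    by apply/funext => S /=; rewrite /F rVofK.
  move=> S; apply: continuous_comp; last exact: cq.
  exact: linear_mx_continuous.
move=> S T hS hT hST c d.
have -> : of_sym (c *: S + d *: T) = c *: of_sym S + d *: of_sym T.
  by rewrite /of_sym mulmxDr -!scalemxAr linearD !linearZ.
apply: hq; apply: val_inj; rewrite /= /mx_comm !val_of_sym//.
by rewrite -!mulmxA !(mulmxA _ J) hST subrr.
Qed.

Lemma dual_of_trace (q : quasi_state g) (G : 'M[R]_m) :
  (forall S, S^T = S -> q (of_sym S) = \tr (S *m G)) -> q \in @dual_pred R g.
Proof.
move=> h; apply/asboolP.
pose f (X : g) : R^o := \tr (- (J *m vsval X) *m G).
have fl : linear f.
  move=> a X Y; rewrite /f.
  have -> : vsval (a *: X + Y) = a *: vsval X + vsval Y by rewrite linearP.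
  rewrite mulmxDr -scalemxAr opprD mulmxDl.
  by rewrite -scalerN -scalemxAl mxtraceD mxtraceZ.
pose L : {linear g -> R^o} := HB.pack f (GRing.isLinear.Build R _ _ _ f fl).
exists (linfun L) => X; rewrite lfunE /= /f -h ?of_symK//.
by apply: sp_symp_mul; exact: subvsP.
Qed.

Hypothesis n3 : (3 <= n)%N.

Lemma darboux_pair : exists e f : 'rV[R]_m, omega e f = 1.
Proof.
have n0 : (0 < m)%N by rewrite addn_gt0 (leq_trans _ n3).
have [|y hy] := @omega_nondeg R n (const_mx 1).
  by apply/rV0Pn; exists (Ordinal n0); rewrite mxE oner_eq0.
exists (const_mx 1), ((omega (const_mx 1) y)^-1 *: y).
by rewrite omegaZr mulVf.
Qed.

(** After its linear part is fitted on squares, a quasi-state is measured by its excess on the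
    elliptic element [E]; excess 0 means linear. The coefficient [c / c'] cancels the excess of [q]
    by that of [r]. *)
Lemma quasi_state_decomposition (q r : quasi_state g) :
  r \notin @dual_pred R g -> exists a, q - a *: r \in @dual_pred R g.
Proof.
move=> nr; have [e [f ef]] := darboux_pair.
have key (s : quasi_state g) (G : 'M[R]_m) :
    (forall x, s (of_sym (sq x)) = \tr (sq x *m G)) ->
    s (of_sym (sq e + sq f)) = \tr ((sq e + sq f) *m G) -> s \in @dual_pred R g.
  move=> hG hE; apply: (@dual_of_trace s G) => S hS.
  pose y S := s (of_sym S) - \tr (S *m G).
  have yq : sym_quasi y := sym_quasiB_linear G (quasi_state_sym_quasi s).
  have ysq x : y (sq x) = 0 by rewrite /y hG subrr.
  apply/eqP; rewrite -subr_eq0; apply/eqP; apply: (sym_quasi_vanish yq _ _ hS).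
    exact: dot_vanish.
  by apply: (sqD_vanish yq ysq n3 ef); rewrite /y hE subrr.
have [G hG] := sq_linear_part (quasi_state_sym_quasi q) n3.
have [G' hG'] := sq_linear_part (quasi_state_sym_quasi r) n3.
pose E := sq e + sq f.
pose c := q (of_sym E) - \tr (E *m G); pose c' := r (of_sym E) - \tr (E *m G').
have c0 : c' != 0.
  apply: contra nr => /eqP; rewrite /c' => /eqP; rewrite subr_eq0 => /eqP h.
  exact: key hG' h.
exists (c / c'); apply: (key _ (G - (c / c') *: G')) => [x|].
  rewrite -[LHS]/(q _ - (c / c') * r _) hG hG' mulmxBr -scalemxAr.
  by rewrite linearB /= mxtraceZ.
rewrite -[LHS]/(q _ - (c / c') * r _) mulmxBr -scalemxAr linearB /= mxtraceZ
  -/E.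
have -> : q (of_sym E) = c + \tr (E *m G) by rewrite /c subrK.
have -> : r (of_sym E) = c' + \tr (E *m G') by rewrite /c' subrK.
by field.
Qed.

Lemma maslov_quasi_state :
  ((fun X : g => maslov (vsval X)) : g -> R^o) \in @quasi_state_pred R g.
Proof.
apply/asboolP; split.
  move=> X Y h c d; rewrite linearD !linearZ /=.
  apply: maslov_linear; try exact: subvsP.
  have := congr1 vsval h; rewrite /= /mx_comm => /eqP.
  by rewrite subr_eq0 => /eqP.
rewrite /continuous_on_coords; set e := vbasis _.
apply: (@maslov_continuous_path R n _ (fun u => vsval (vecof e u))) => [i j|u];
  last exact: subvsP.
move=> u; apply: (@continuous_comp _ _ _ (fun u => vsval (vecof e u))
  (fun A : 'M[R]_m => A i j)); last exact: coord_continuous.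
exact: (@linear_mx_continuous _ _ _ _ _ (@vsval _ _ (sp_space R n) \o vecof e)).
Qed.

Definition maslov_state : quasi_state g := QuasiState maslov_quasi_state.

(** [J] is the sum of two nilpotent elements, each of which kills an isotropic space of dimension
    [n] and so has value 0, whereas [J] has value [- n]. *)
Lemma maslov_state_nonlinear : maslov_state \notin @dual_pred R g.
Proof.
apply/negP => /asboolP[f hf].
pose X : 'M[R]_m := block_mx 0 1%:M 0 0.
pose Y : 'M[R]_m := block_mx 0 0 (- 1%:M) 0.
have XY : X + Y = J by rewrite add_block_mx !addr0 !add0r.
have hX : X \in sp_space R n.
  apply/sp_spaceP; rewrite tr_block_mx !trmx0 trmx1 /symp_form !mulmx_block.
  by rewrite !(mulmx0, mul0mx, mulmx1, mul1mx, addr0, add0r) add_block_mx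
    !addr0 subrr block_mx0.
have hY : Y \in sp_space R n.
  apply/sp_spaceP; rewrite tr_block_mx !trmx0 linearN /= trmx1 /symp_form.
  rewrite !mulmx_block !(mulmx0, mul0mx, mulmx1, mul1mx, addr0, add0r).
  by rewrite add_block_mx !mulNmx !mul1mx !addr0 addNr block_mx0.
have free (k l : 'M[R[i]]_n) : (k \in unitmx) || (l \in unitmx) ->
    row_free (row_mx k l).
  case/orP => u; apply/row_freeP.
    exists (col_mx (invmx k) 0).
    by rewrite mul_row_col mulmxV// mulmx0 addr0.
  by exists (col_mx 0 (invmx l)); rewrite mul_row_col mulmxV// mulmx0 add0r.
have mX : maslov X = 0.
  apply: maslovE => //; exists (row_mx 0 1%:M), 0; split.
  - by apply: free; rewrite unitmx1 orbT.
  - move=> x /submxP[p ->]; rewrite mul_mx_row mulmx0 hform_row.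
    by rewrite mul0mx trmx0 map_mx0 mulmx0 subrr mulr0.
  - rewrite map_block_mx !map_mx0 map_mx1 mul_row_block.
    by rewrite !(mulmx0, mul0mx, addr0) row_mx0.
  - by rewrite linear0.
have mY : maslov Y = 0.
  apply: maslovE => //; exists (row_mx 1%:M 0), 0; split.
  - by apply: free; rewrite unitmx1.
  - move=> x /submxP[p ->]; rewrite mul_mx_row mulmx0 hform_row.
    by rewrite mul0mx trmx0 map_mx0 mulmx0 subrr mulr0.
  - rewrite map_block_mx !map_mx0 mul_row_block.
    by rewrite !(mulmx0, mul0mx, addr0) row_mx0.
  - by rewrite linear0.
have mJ : maslov J = - n%:R.
  apply: maslovE; first by rewrite -XY memvD.
  (* The positive definite space of the vectors [(a, i a)] is the eigenspace of [J] for [- i]. *)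
  exists (row_mx 1%:M 'i%C%:M), ((- 'i%C)%:M); split.
  - by apply: free; rewrite unitmx1.
  - move=> x /submxP[p ->]; rewrite mul_mx_row mulmx1 mul_mx_scalar hform_row.
    rewrite linearZ /= map_mxZ /= -scalemxAr -scalemxAl !scalemx00 conj_i.
    have -> (c : R[i]) : 'i%C * (- 'i%C * c - 'i%C * c) = 2 * c.
      by transitivity (- ('i%C ^+ 2) * 2 * c); [ring|rewrite sqr_i; ring].
    by rewrite mulr_ge0 ?ler0n//; have [] := dot_ge0 p.
  - rewrite map_block_mx !map_mx0 map_mxN map_mx1 mul_row_block.
    rewrite !(mulmx0, mul0mx, addr0, add0r) mulmxN !mulmx1 mul_mx_row mulmx1.
    by rewrite -scalar_mxM mulNr -expr2 sqr_i opprK raddfN.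
  - rewrite mxtrace_scalar.
    by elim: (n) => [|k IH]; rewrite ?mulr0n ?oppr0// mulrSr ImD -IH mulrSr
      opprD.
have : maslov_state (Subvs hX + Subvs hY) =
    maslov_state (Subvs hX) + maslov_state (Subvs hY) by rewrite !hf linearD.
have -> : Subvs hX + Subvs hY = Subvs (memvD hX hY) by exact: val_inj.
rewrite /= mX mY XY mJ addr0 => /eqP; rewrite oppr_eq0 pnatr_eq0.
by case: n n3.
Qed.

End Assembly.

(** * The class of the Maslov quasi-state as a basis of the quotient *)

Theorem theorem1p1 (R : realType) (n : nat) (hn : (3 <= n)%N) :
  has_dim 1 (quasi_state_mod_dual (sp R n)).
Proof.
pose mu := maslov_state R n; pose D := @dual_pred R (sp R n).
pose w : quasi_state_mod_dual (sp R n) := lmod_quot_proj D mu.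
have projZ a x : lmod_quot_proj D (a *: x) = a *:
  lmod_quot_proj D x :> quasi_state_mod_dual (sp R n).
  exact: lmod_quot_projZ.
have w_inj a b : a *: w = b *: w -> a = b.
  move=> ab; apply/eqP; rewrite -subr_eq0; apply:
    contraNT (maslov_state_nonlinear R hn).
  move=> nz; have : (a - b) *: mu \in D.
    rewrite scalerBl; apply/lmod_quot_projP; rewrite !projZ.
    exact: ab.
  by move=> /(rpredZ (a - b)^-1); rewrite scalerA mulVf// scale1r.
(* The coordinate is obtained by choice; its linearity follows from uniqueness, [w_inj]. *)
have /choice[phi hphi] : forall x, exists a, x = a *: w.
  move=> x; have [a ha] := quasi_state_decomposition hn (repr x)
    (maslov_state_nonlinear R hn).
  exists a; rewrite -projZ -[LHS](@lmod_quot_reprK _ _ D x).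
  exact/lmod_quot_projP.
have lin : linear (fun x => const_mx (phi x) : 'rV[R]_1).
  move=> a x y; apply/rowP => i; rewrite !mxE; apply: w_inj.
  by rewrite -hphi scalerDl -scalerA -!hphi.
constructor; exists (fun x => const_mx (phi x)) => //.
exists (fun r : 'rV[R]_1 => r 0 0 *: w) => [x|r].
  by rewrite mxE -hphi.
by apply/rowP => i; rewrite mxE ord1; apply: w_inj; rewrite -hphi.
Qed.
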